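(* Let $s$ be an odd prime power. For $1<k\le (s^n-1)/(s-1)$, let $h_1,\dots,h_k$ be $k$ distinct functions in $H(X_1,\dots,X_n)$. The column juxtaposition of $Q^*_{h_i}(X_1,\dots,X_n)$, $i=1,\dots,k$, forms an $SSD(s^n,s^m)$ with $m=k(s^n-s)/(s-1)$. There are no fully aliased columns and the possible projected $A_2$ values are $0$, $(s-1)^2/s^2$ and $(s-1)/s^2$. There are $\binom{k}{2}s^2$ pairs with projected $A_2=(s-1)^2/s^2$ and $\binom{k}{2}s^2(s^n-s^2)/(s-1)$ pairs with projected $A_2=(s-1)/s^2$. It has overall $A_2=\binom{k}{2}(s^n-2s+1)$. When $k=(s^n-1)/(s-1)-1$ or $k=(s^n-1)/(s-1)$, the SSD is optimal under GMA.
   Context: Designs: $SSD(N,s^m)$ denotes an $N\times m$ matrix $D=[x_{ik}]$ with entries in a set of $s$ symbols (here the finite field $F_s$ with $s$ elements), which is balanced: in every column each symbol appears exactly $N/s$ times. Generalized wordlength pattern: choose orthonormal contrasts on the symbol set, i.e. complex-valued functions $c_1,\dots,c_{s-1}$ on the symbols with $\sum_x c_a(x)=0$ and $\sum_x c_a(x)\overline{c_b(x)}=s$ if $a=b$ and $0$ otherwise. For $j=1,\dots,m$, $$A_j(D)=N^{-2}\sum_{K\subseteq\{1,\dots,m\},\,|K|=j}\ \sum_{(a_k)_{k\in K}\in\{1,\dots,s-1\}^K}\Big|\sum_{i=1}^N\prod_{k\in K}c_{a_k}(x_{ik})\Big|^2 ,$$ independently of the choice of contrasts. The overall $A_2$ is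 $A_2(D)$; the projected $A_2$ value of a pair of columns is $A_2$ of the two-column design they form. $D$ is optimal under GMA (generalized minimum aberration) if there is no $SSD(N,s^m)$ $D'$ and index $r$ with $A_j(D')=A_j(D)$ for all $j<r$ and $A_r(D')<A_r(D)$. Polynomial columns: a function $f(X_1,\dots,X_n)$ on $F_s^n$ gives a column of length $s^n$, rows being indexed by the points of $F_s^n$; a set of functions gives the design with the corresponding columns. $H(X_1,\dots,X_n)$ is the set of nonzero linear forms $c_1X_1+\cdots+c_nX_n$ ($c_i\in F_s$) whose last nonzero coefficient is $1$. For any variables (independent linear forms) $Y_1,\dots,Y_n$, $Q_1^*(Y_1,\dots,Y_n)=\{Y_1^2+aY_1+g: a\in F_s,\ g\in H(Y_2,\dots,Y_n)\}$, where $H(Y_2,\dots,Y_n)$ is the set of nonzero linear forms in $Y_2,\dots,Y_n$ whose last nonzero coefficient is $1$. For $h=c_1X_1+\cdots+c_nX_n\in H(X_1,\dots,X_n)$, let $l$ be the largest index with $c_l\ne0$ (so $c_l=1$), put $Y_1=h$, $Y_i=X_{i-1}$ for $2\le i\le l$, $Y_i=X_i$ for $l<i\le n$, and define $Q^*_h(X_1,\dots,X_n)=Q^*_1(Y_1,\dots,Y_n)$ (as functions on $F_s^n$ in $X_1,\dots,X_n$). Two columns of length $s^n$ are fully aliased if the pair has only $s$ distinct level combinations, each occurring $s^{n-1}$ times. *)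

(* Defs.v *)
From HB Require Import structures.
From mathcomp Require Import all_boot all_order all_algebra.
Set Implicit Arguments.
Unset Strict Implicit.
Unset Printing Implicit Defensive.
Import Order.TTheory GRing.Theory Num.Theory.
Local Open Scope ring_scope.

(* Designs. A design is an array [D : I -> J -> S] whose rows and columns are
   labelled by arbitrary finite types; an actual N x m matrix is the case
   I = 'I_N, J = 'I_m. The complex numbers are any numClosedFieldType. *)

Definition is_SSD (S I J : finType) (N m : nat) (D : I -> J -> S) : Prop :=
  [/\ #|I| = N, #|J| = m &
      forall (k : J) (x : S), (#|[set i | D i k == x]| * #|S|)%N = N].

Definition orthonormal_contrasts (C : numClosedFieldType) (S : finType)
    (c : 'I_#|S|.-1 -> S -> C) : Prop :=
  (forall a, \sum_(x : S) c a x = 0) /\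
  (forall a b, \sum_(x : S) c a x * (c b x)^* = if a == b then #|S|%:R else 0).

(* The value A_j(D), computed with the contrasts c. *)
Definition gwlp (C : numClosedFieldType) (S : finType)
    (c : 'I_#|S|.-1 -> S -> C) (I J : finType) (j : nat) (D : I -> J -> S) : C :=
  #|I|%:R ^- 2 *
  \sum_(K : {set J} | #|K| == j)
    \sum_(a : {ffun {k : J | k \in K} -> 'I_#|S|.-1})
      `| \sum_(i : I) \prod_(k : {k : J | k \in K}) c (a k) (D i (val k)) | ^+ 2.

Definition subdesign (S I J : finType) (D : I -> J -> S) (K : {set J}) :
    I -> {k : J | k \in K} -> S :=
  fun i k => D i (val k).
Arguments subdesign {S I J} D K i k.

Definition projected_A2 (C : numClosedFieldType) (S : finType)
    (c : 'I_#|S|.-1 -> S -> C) (I J : finType) (D : I -> J -> S)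
    (K : {set J}) : C :=
  gwlp c 2 (subdesign D K).

Definition GMA_optimal (C : numClosedFieldType) (S : finType)
    (c : 'I_#|S|.-1 -> S -> C) (N m : nat) (I J : finType)
    (D : I -> J -> S) : Prop :=
  ~ exists (D' : 'M[S]_(N, m)) (r : nat),
      [/\ is_SSD N m D', (1 <= r <= m)%N,
          forall j : nat, (1 <= j < r)%N -> gwlp c j D' = gwlp c j D
        & gwlp c r D' < gwlp c r D].

Notation column F n := {ffun 'rV[F]_n -> F}.

Definition fully_aliased (F : finFieldType) (n : nat) (J : finType)
    (D : 'rV[F]_n -> J -> F) (k l : J) : Prop :=
  let combos := [set (D x k, D x l) | x : 'rV[F]_n] in
  #|combos| = #|F| /\
  (forall p : F * F, p \in combos ->
     #|[set x | (D x k, D x l) == p]| = (#|F| ^ n.-1)%N).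

(* Labels of the columns of the juxtaposition of Q 0, ..., Q k.-1: columns from
   different sets are kept apart even if they coincide. *)
Definition jlabel (F : finFieldType) (n k : nat)
    (Q : 'I_k -> {set column F n}) : finType :=
  {q : 'I_k * column F n | q.2 \in Q q.1}.

Definition juxtaposition (F : finFieldType) (n k : nat)
    (Q : 'I_k -> {set column F n}) : 'rV[F]_n -> jlabel Q -> F :=
  fun x q => (val q).2 x.
Arguments juxtaposition {F n k} Q x q.

Definition X_ (F : finFieldType) (n : nat) (i : 'I_n) : column F n :=
  [ffun x : 'rV[F]_n => x 0 i].
Arguments X_ F n i : clear implicits.

Definition lincomb (F : finFieldType) (n p : nat) (Y : 'I_p -> column F n)
    (c : 'rV[F]_p) : column F n :=
  [ffun x => \sum_(i < p) c 0 i * Y i x].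

(* The last nonzero entry of c is at position l and equals 1 (so c != 0). *)
Definition last_is_one (F : finFieldType) (p : nat) (c : 'rV[F]_p) (l : 'I_p) :
    bool :=
  (c 0 l == 1) && [forall i : 'I_p, (l < i)%N ==> (c 0 i == 0)].

Definition H (F : finFieldType) (n p : nat) (Y : 'I_p -> column F n) :
    {set column F n} :=
  [set lincomb Y c | c : 'rV[F]_p & [exists l, last_is_one c l]].

(* Q_1^* (Y_1, ..., Y_n), with (Y_2, ..., Y_n) given as the family Y. *)
Definition Q1star (F : finFieldType) (n p : nat) (Y1 : column F n)
    (Y : 'I_p -> column F n) : {set column F n} :=
  [set [ffun x => Y1 x ^+ 2 + a * Y1 x + g x] | a : F, g : column F n in H Y].

(* For h = c_1 X_1 + ... + c_n X_n with largest nonzero index l, the variables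
   are Y_1 = h and (Y_2, ..., Y_n) = (X_1, ..., X_n) with X_l left out, that is,
   the family X_ F n \o lift l. The pair (c, l) is unique when h is in
   H (X_ F n); the value at other h is irrelevant. *)
Definition Qstar (F : finFieldType) (n : nat) (h : column F n) :
    {set column F n} :=
  if [pick cl : 'rV[F]_n * 'I_n |
        (h == lincomb (X_ F n) cl.1) && last_is_one cl.1 cl.2] is Some (_, l)
  then Q1star h (fun i : 'I_n.-1 => X_ F n (lift l i))
  else set0.

(* Main.v *)
Require Import Defs.
From HB Require Import structures.
From mathcomp Require Import all_boot all_order all_algebra.
From mathcomp Require Import ring lra.
Set Implicit Arguments.
Unset Strict Implicit.
Unset Printing Implicit Defensive.
Import Order.TTheory GRing.Theory Num.Theory.
Local Open Scope ring_scope.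

(** Let s be the number of symbols, N the number of rows, and D_k the k-th
    column of the design D. Completing the contrasts by the constant 1 gives
    a unitary matrix up to scaling, so N^2 A_j is the sum over pairs of rows i, i'
    and over j-sets K of columns of the products over k in K of
    s [D_k(i) = D_k(i')] - 1 ([gwlpE]). Hence A_j only depends on the numbers of
    coincidences of pairs of rows, and the value of a pair of balanced columns only
    on the number of pairs of rows in which both columns agree.

    For a column f = h^2 + L over a field of odd order, f(y + d) = f(y) is a linear
    equation in y if h(d) is nonzero, and the condition L(d) = 0 on d otherwise.
    Counting solutions for each d gives all projected values ([pairA2_same],
    [pairA2_diff]). For distinct forms h, h' with span
    W, the value is (s - 1)^2 / s^2 if both linear parts lie in W, (s - 1) / s^2 if
    neither does but they are proportional modulo W, and 0 otherwise. W contains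
    exactly one normalised form without a given variable of coefficient 1 in h,
    which gives s^2 pairs of the first kind ([card_pairA2_large]).

    In one family Q_h^*, the number of columns that agree at two distinct points x, y
    is M = (s^(n-1) - 1) / (s - 1) if h(x - y) is nonzero, and M - 1 otherwise
    ([card_agree_family]). Exchanging sums, this yields the total of the projected
    values between two families ([sum_pairA2_families]), hence the number of pairs
    of the second kind and the overall A_2. Summed over all families, it gives
    k M - z coincidences, where z counts the forms h_i that vanish at x - y; if at
    most one normalised form is missing, z is M or M - 1 ([card_forms_zero]).

    A balanced design whose coincidence numbers take at most two consecutive values
    q, q + 1 is optimal ([gma_two_values]): balance fixes their sum, and A_2 is,
    up to an additive constant, a positive multiple of the sum of
    (d - q) (d - q - 1) over pairs of distinct rows with d coincidences; each term
    is nonnegative, as d is an integer, and vanishes if d is q or q + 1. A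
    competitor with the same A_2 has its coincidence numbers in {q, q + 1} as well,
    hence the same distribution and the same A_j for all j. *)

(** * Wordlength patterns and row coincidences *)

(** The contrasts completed by the constant 1 form a square matrix with
    orthogonal rows; its columns are then orthogonal as well. *)
Lemma contrast_dual (C : numClosedFieldType) (S : finType)
    (c : 'I_#|S|.-1 -> S -> C) (x y : S) : orthonormal_contrasts c ->
  \sum_a c a x * (c a y)^* = #|S|%:R * (x == y)%:R - 1.
Proof.
move=> [c0 c1].
have S_gt0 : (0 < #|S|)%N by apply/card_gt0P; exists x.
have eS : (1 + #|S|.-1)%N = #|S| by rewrite add1n prednK.
have sN0 : #|S|%:R != 0 :> C by rewrite pnatr_eq0 -lt0n.
pose f (i : 'I_(1 + #|S|.-1)) : S := enum_val (cast_ord eS i).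
pose g (z : S) : 'I_(1 + #|S|.-1) := cast_ord (esym eS) (enum_rank z).
have fK : cancel f g by move=> i; rewrite /f /g enum_valK cast_ordK.
have gK : cancel g f by move=> z; rewrite /f /g cast_ordKV enum_rankK.
pose e (i : 'I_(1 + #|S|.-1)) (z : S) : C :=
  if split i is inr a then c a z else 1.
have eE i i' : \sum_z e i z * (e i' z)^* = #|S|%:R * (i == i')%:R.
  have ii'E : (i == i') = (nat_of_ord i == nat_of_ord i') by [].
  rewrite /e; case: (splitP i) => a ia; case: (splitP i') => b ib.
  - under eq_bigr do rewrite rmorph1 mulr1.
    have -> : i == i' by rewrite ii'E ia ib !ord1.
    by rewrite sumr_const mulr1.
  - under eq_bigr do rewrite mul1r.
    have -> : (i == i') = false by rewrite ii'E ia ib ord1.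
    by rewrite -rmorph_sum c0 rmorph0 mulr0.
  - under eq_bigr do rewrite rmorph1 mulr1.
    have -> : (i == i') = false by rewrite ii'E ia ib ord1.
    by rewrite c0 mulr0.
  - rewrite c1 ii'E ia ib eqn_add2l val_eqE.
    by case: (a == b); rewrite ?mulr1 ?mulr0.
have e0 z : e (lshift _ ord0) z = 1 by rewrite /e (unsplitK (inl _)).
have e1 a z : e (rshift 1 a) z = c a z by rewrite /e (unsplitK (inr _)).
pose U := \matrix_(i, j) e i (f j).
pose V := \matrix_(j, i) (#|S|%:R^-1 * (e i (f j))^*).
have UV : U *m V = 1%:M.
  apply/matrixP => i i'; rewrite !mxE.
  transitivity (#|S|%:R^-1 * \sum_z e i z * (e i' z)^*).
    rewrite (reindex f) /=; last by exists g => z _; rewrite ?fK ?gK.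
    by rewrite mulr_sumr; apply: eq_bigr => j _; rewrite !mxE mulrCA.
  by rewrite eE mulKf.
have /matrixP/(_ (g y) (g x)) := mulmx1C UV.
rewrite !mxE (inj_eq (can_inj gK)) big_split_ord /= big_ord1 !mxE !gK.
rewrite !e0 rmorph1 !mulr1 => exy.
have {exy} := congr1 ( *%R #|S|%:R) exy.
rewrite mulrDr mulfV // mulr_sumr eq_sym => <-; rewrite addrC addKr.
by apply: eq_bigr => a _; rewrite !mxE !gK !e1 mulrC mulrA mulVKf.
Qed.

(** Expanding the squared moduli over pairs of rows eliminates the contrasts. *)
Lemma gwlpE (C : numClosedFieldType) (S : finType) (c : 'I_#|S|.-1 -> S -> C)
    (I J : finType) (j : nat) (D : I -> J -> S) : orthonormal_contrasts c ->
  gwlp c j D = #|I|%:R ^- 2 * \sum_(K : {set J} | #|K| == j)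
    \sum_i \sum_i' \prod_(k in K) (#|S|%:R * (D i k == D i' k)%:R - 1).
Proof.
move=> hc; congr (_ * _); apply: eq_bigr => K _.
pose G (k : {k | k \in K}) (a : 'I_#|S|.-1) i := c a (D i (val k)).
transitivity (\sum_(a : {ffun {k | k \in K} -> 'I_#|S|.-1}) \sum_i \sum_i'
   \prod_k (G k (a k) i * (G k (a k) i')^*)).
  apply: eq_bigr => a _; rewrite normCK rmorph_sum /= mulr_suml.
  apply: eq_bigr => i _; rewrite mulr_sumr; apply: eq_bigr => i' _.
  by rewrite rmorph_prod /= -big_split.
rewrite exchange_big; apply: eq_bigr => i _.
rewrite exchange_big; apply: eq_bigr => i' _.
rewrite -(bigA_distr_bigA (fun k a => G k a i * (G k a i')^*)) /=.
by rewrite [RHS]big_sub; apply: eq_bigr => k _; rewrite contrast_dual.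
Qed.

(** The number of coincidences of two rows of a design. *)
Definition coincidence (S I J : finType) (D : I -> J -> S) (i i' : I) : nat :=
  #|[set k | D i k == D i' k]|.

(** The Krawtchouk-type polynomial values through which the wordlength pattern
    depends on the coincidence numbers: the coefficient of X^j in
    (1 + (s - 1) X)^d (1 - X)^(m - d). *)
Definition krawt (R : comNzRingType) (s m j d : nat) : R :=
  ((1 + (s%:R - 1) *: 'X) ^+ d * (1 + (-1) *: 'X) ^+ (m - d))`_j.

Lemma sum_prod_krawt (R : comNzRingType) (S J : finType) (u v : J -> S) (j : nat) :
  \sum_(K : {set J} | #|K| == j)
     \prod_(k in K) (#|S|%:R * (u k == v k)%:R - 1)
  = krawt R #|S| #|J| j #|[set k | u k == v k]|.
Proof.
pose w k : R := #|S|%:R * (u k == v k)%:R - 1.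
transitivity ((\prod_k (w k *: 'X + 1))`_j).
  rewrite bigA_distr coef_sum big_mkcond /=; apply: eq_bigr => K _.
  rewrite -big_mkcond /= scaler_prod prodr_const coefZ coefXn eq_sym.
  by case: eqP; rewrite ?mulr1 ?mulr0.
rewrite /krawt (bigID (mem [set k | u k == v k])) /=.
congr ((_ * _ : {poly R})`_j).
  rewrite -prodr_const; apply: eq_bigr => k; rewrite inE => uv.
  by rewrite /w uv mulr1 addrC.
have -> : (#|J| - #|[set k | u k == v k]|)%N = #|~: [set k | u k == v k]|.
  by rewrite -(cardsC [set k | u k == v k]) addKn.
rewrite -prodr_const; apply: eq_big => k; first by rewrite !inE.
by rewrite inE => uv; rewrite /w (negPf uv) mulr0 sub0r addrC.
Qed.

Lemma gwlp_krawt (C : numClosedFieldType) (S : finType)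
    (c : 'I_#|S|.-1 -> S -> C) (I J : finType) (j : nat) (D : I -> J -> S) :
  orthonormal_contrasts c ->
  gwlp c j D = #|I|%:R ^- 2 *
    \sum_i \sum_i' krawt C #|S| #|J| j (coincidence D i i').
Proof.
move=> hc; rewrite gwlpE //; congr (_ * _).
rewrite exchange_big; apply: eq_bigr => i _ /=.
by rewrite exchange_big; apply: eq_bigr => i' _ /=; rewrite sum_prod_krawt.
Qed.

Lemma coef_linear_exp (R : comNzRingType) (a : R) (d : nat) :
  let p := (1 + a *: 'X) ^+ d in
  [/\ p`_0 = 1, p`_1 = d%:R * a & p`_2 *+ 2 = d%:R * (d%:R - 1) * a ^+ 2].
Proof.
have pS (p : {poly R}) i :
    (p * (1 + a *: 'X))`_i = p`_i + (if i is i'.+1 then a * p`_i' else 0).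
  rewrite mulrDr mulr1 coefD -scalerAr coefZ coefMX.
  by case: i => [|i] //=; rewrite mulr0.
elim: d => [|d [IH0 IH1 IH2]] /=.
  by rewrite expr0 !coef1 /= !mul0r mul0rn.
rewrite exprSr !pS /= IH0 IH1 mulrnDl IH2 -natr1; split; ring.
Qed.

Lemma krawt1 (R : comNzRingType) (s m d : nat) : (d <= m)%N ->
  krawt R s m 1 d = s%:R * d%:R - m%:R.
Proof.
move=> le_dm; rewrite /krawt coefM !big_ord_recl big_ord0 /= /bump /= subn0.
have [-> -> _] := coef_linear_exp (s%:R - 1 : R) d.
have [-> -> _] := coef_linear_exp (-1 : R) (m - d).
rewrite natrB //; ring.
Qed.

Lemma krawt2 (R : comNzRingType) (s m d : nat) : (d <= m)%N ->
  krawt R s m 2 d *+ 2 = (s%:R * d%:R - m%:R) ^+ 2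
    - (s%:R - 2) * s%:R * d%:R - m%:R.
Proof.
move=> le_dm; rewrite /krawt coefM !big_ord_recl big_ord0 /= /bump /= subn0.
have [-> -> E] := coef_linear_exp (s%:R - 1 : R) d.
have [-> -> E'] := coef_linear_exp (-1 : R) (m - d).
rewrite mul1r mulr1 addr0 addn0 !mulrnDl E E' natrB //; ring.
Qed.

(** In a balanced design the total number of coincidences is determined. *)
Lemma sum_coincidence (S I J : finType) (N m : nat) (D : I -> J -> S) :
  is_SSD N m D ->
  ((\sum_i \sum_i' coincidence D i i') * #|S| = m * N ^ 2)%N.
Proof.
case=> cI cJ bal.
have -> : (\sum_i \sum_i' coincidence D i i' =
           \sum_k \sum_i #|[set i' | D i' k == D i k]|)%N.
  rewrite [RHS]exchange_big; apply: eq_bigr => i _ /=.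
  under eq_bigr do rewrite /coincidence -sum1dep_card.
  rewrite (exchange_big_dep predT) //=; apply: eq_bigr => k _.
  by rewrite -sum1dep_card; apply: eq_bigl => i'; rewrite eq_sym.
rewrite big_distrl /= -cJ -sum_nat_const; apply: eq_bigr => k _.
rewrite big_distrl /= (eq_bigr (fun=> N)) => [|i _]; last exact: bal.
by rewrite sum_nat_const cI.
Qed.

Lemma coincidence_le (S I J : finType) (D : I -> J -> S) i i' :
  (coincidence D i i' <= #|J|)%N.
Proof. exact: max_card. Qed.

Lemma coincidence_diag (S I J : finType) (D : I -> J -> S) i :
  coincidence D i i = #|J|.
Proof. by rewrite -[RHS]cardsT; apply: eq_card => k; rewrite !inE eqxx. Qed.

(** A sum over pairs of distinct rows of a function of the coincidence number. *)
Definition offdiag (R : comNzRingType) (S I J : finType) (D : I -> J -> S)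
    (f : nat -> R) : R :=
  \sum_i \sum_(i' | i' != i) f (coincidence D i i').

Lemma sum_offdiag (R : comNzRingType) (S I J : finType) (D : I -> J -> S)
    (f : nat -> R) :
  \sum_i \sum_i' f (coincidence D i i') = #|I|%:R * f #|J| + offdiag D f.
Proof.
rewrite mulr_natl -sumr_const -big_split; apply: eq_bigr => i _ /=.
by rewrite (bigD1 i) //= coincidence_diag.
Qed.

Lemma offdiagD (R : comNzRingType) (S I J : finType) (D : I -> J -> S)
    (f g : nat -> R) :
  offdiag D (fun d => f d + g d) = offdiag D f + offdiag D g.
Proof.
by rewrite -big_split; apply: eq_bigr => i _; rewrite -big_split.
Qed.

Lemma offdiagZ (R : comNzRingType) (S I J : finType) (D : I -> J -> S)
    (a : R) (f : nat -> R) :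
  offdiag D (fun d => a * f d) = a * offdiag D f.
Proof.
by rewrite mulr_sumr; apply: eq_bigr => i _; rewrite mulr_sumr.
Qed.

Lemma offdiag_const (R : comNzRingType) (S I J : finType) (D : I -> J -> S)
    (a : R) :
  offdiag D (fun=> a) = (#|I| * #|I|.-1)%:R * a.
Proof.
rewrite /offdiag mulr_natl mulnC mulrnA -sumr_const; apply: eq_bigr => i _.
rewrite sumr_const; congr (_ *+ _).
by rewrite -(cardC1 i); apply: eq_card => x; rewrite !inE.
Qed.

Lemma eq_offdiag (R : comNzRingType) (S I J : finType) (D : I -> J -> S)
    (f g : nat -> R) :
  (forall i i', i' != i ->
     f (coincidence D i i') = g (coincidence D i i')) ->
  offdiag D f = offdiag D g.
Proof. by move=> fg; apply: eq_bigr => i _; apply: eq_bigr => i' /fg. Qed.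

(** Balance fixes the mean of the coincidence numbers, hence every sum of an
    affine function of them. *)
Lemma offdiag_affine (C : numFieldType) (S I J I' J' : finType) (N m : nat)
    (D : I -> J -> S) (D' : I' -> J' -> S) (a b : C) : (0 < #|S|)%N ->
  is_SSD N m D -> is_SSD N m D' ->
  offdiag D' (fun d => a * d%:R + b) = offdiag D (fun d => a * d%:R + b).
Proof.
move=> S_gt0 ssdD ssdD'; have [cI cJ _] := ssdD; have [cI' cJ' _] := ssdD'.
rewrite !offdiagD !offdiagZ !offdiag_const cI cI'; congr (a * _ + _).
have SN0 : #|S|%:R != 0 :> C by rewrite pnatr_eq0 -lt0n.
have eq_tot : \sum_i \sum_i' (coincidence D' i i')%:R =
              \sum_i \sum_i' (coincidence D i i')%:R :> C.
  apply: (mulIf SN0).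
  transitivity ((m * N ^ 2)%:R : C).
    rewrite -(sum_coincidence ssdD') natrM natr_sum; congr (_ * _).
    by apply: eq_bigr => i _; rewrite natr_sum.
  rewrite -(sum_coincidence ssdD) natrM natr_sum; congr (_ * _).
  by apply: eq_bigr => i _; rewrite natr_sum.
move: eq_tot; rewrite !(sum_offdiag _ (fun d => d%:R : C)) cI cI' cJ cJ'.
exact: addrI.
Qed.

(** A balanced design in which the coincidence numbers of distinct rows take at
    most two consecutive values has generalized minimum aberration. *)
Lemma gma_two_values (C : numClosedFieldType) (S : finType)
    (c : 'I_#|S|.-1 -> S -> C) (N m q : nat) (I J : finType)
    (D : I -> J -> S) : orthonormal_contrasts c -> (0 < #|S|)%N ->
  is_SSD N m D ->
  (forall i i', i' != i ->
     coincidence D i i' = q \/ coincidence D i i' = q.+1) ->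
  GMA_optimal c N m D.
Proof.
move=> hc S_gt0 ssdD two [D' [r [ssdD' /andP[r_gt0 _] eqA ltA]]].
have [cI cJ _] := ssdD; have [cI' cJ' _] := ssdD'.
have sN0 : #|S|%:R != 0 :> C by rewrite pnatr_eq0 -lt0n.
have gwlpd j : gwlp c j D' - gwlp c j D =
    N%:R ^- 2 * (offdiag D' (krawt C #|S| m j) - offdiag D (krawt C #|S| m j)).
  rewrite !gwlp_krawt // !sum_offdiag cI cI' cJ cJ' -mulrBr; congr (_ * _); ring.
(* w >= 0 on the naturals, with equality exactly at q and q.+1 *)
pose w (d : nat) : C := (d%:R - q%:R) * (d%:R - q.+1%:R).
have w_ge0 d : 0 <= w d.
  rewrite /w; have [le_dq|lt_qd] := leqP d q.
    by rewrite mulr_le0 // subr_le0 ler_nat // ltnW.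
  by rewrite mulr_ge0 // subr_ge0 ler_nat // ltnW.
have w_eq0 d : w d = 0 -> d = q \/ d = q.+1.
  move/eqP; rewrite mulf_eq0 !subr_eq0 !eqr_nat.
  by case/orP => /eqP; [left | right].
have wD0 : offdiag D w = 0.
  rewrite /offdiag big1 // => i _; rewrite big1 // => i' ii'.
  by rewrite /w; case: (two i i' ii') => ->; rewrite subrr ?mul0r ?mulr0.
have wD'_ge0 : 0 <= offdiag D' w.
  by apply: sumr_ge0 => i _; apply: sumr_ge0 => i' _.
have A1 : gwlp c 1 D' = gwlp c 1 D.
  apply/eqP; rewrite -subr_eq0 gwlpd.
  have E (I1 J1 : finType) (D1 : I1 -> J1 -> S) : #|J1| = m ->
      offdiag D1 (krawt C #|S| m 1) =
      offdiag D1 (fun d => #|S|%:R * d%:R + - m%:R).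
    move=> cJ1; apply: eq_offdiag => i i' _; rewrite krawt1 //.
    by rewrite -cJ1 coincidence_le.
  by rewrite !E // (offdiag_affine _ _ S_gt0 ssdD ssdD') subrr mulr0.
have A2 : gwlp c 2 D' - gwlp c 2 D =
    N%:R ^- 2 * ((#|S|%:R ^+ 2 / 2) * offdiag D' w).
  rewrite gwlpd; congr (_ * _).
  (* the second Krawtchouk value is s^2 / 2 times w plus an affine function *)
  pose a : C := (#|S|%:R ^+ 2 * (q%:R + q.+1%:R) - 2 * #|S|%:R * m%:R
                 - (#|S|%:R - 2) * #|S|%:R) / 2.
  pose b : C := (m%:R ^+ 2 - m%:R - #|S|%:R ^+ 2 * (q%:R * q.+1%:R)) / 2.
  have E (I1 J1 : finType) (D1 : I1 -> J1 -> S) : #|J1| = m ->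
      offdiag D1 (krawt C #|S| m 2) =
      (#|S|%:R ^+ 2 / 2) * offdiag D1 w + offdiag D1 (fun d => a * d%:R + b).
    move=> cJ1; rewrite -offdiagZ -offdiagD; apply: eq_offdiag => i i' _.
    have le_m : (coincidence D1 i i' <= m)%N by rewrite -cJ1 coincidence_le.
    have n20 : 2 != 0 :> C by rewrite pnatr_eq0.
    apply: (mulIf n20); rewrite (mulr_natr (krawt _ _ _ _ _)) krawt2 //.
    by rewrite /a /b /w; field.
  rewrite !E // (offdiag_affine _ _ S_gt0 ssdD ssdD') wD0; ring.
case: r r_gt0 eqA ltA => [//|[|[|r]]] _ eqA.
- by rewrite A1 ltxx.
- rewrite -subr_lt0 A2 => lt0; have : 0 <= N%:R ^- 2 * (#|S|%:R ^+ 2 / 2 * offdiag D' w).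
    by rewrite !mulr_ge0 ?invr_ge0 ?exprn_ge0 ?ler0n.
  by move/(lt_le_trans lt0); rewrite ltxx.
have N0 : (N == 0)%N || (offdiag D' w == 0).
  move: A2; rewrite (eqA 2%N) // subrr => /esym/eqP.
  by rewrite !mulf_eq0 !invr_eq0 !expf_eq0 /= (negPf sN0) !pnatr_eq0 orbF.
suff eq_r : gwlp c r.+3 D' = gwlp c r.+3 D by rewrite eq_r ltxx.
apply/eqP; rewrite -subr_eq0 gwlpd.
case/orP: N0 => [|/eqP wD'0].
  by rewrite -(pnatr_eq0 C) => /eqP ->; rewrite expr0n invr0 mul0r.
have two' i i' : i' != i ->
    coincidence D' i i' = q \/ coincidence D' i i' = q.+1.
  move=> ii'; apply: w_eq0; move: wD'0.
  move/eqP; rewrite psumr_eq0 => [|x _]; last exact: sumr_ge0.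
  move=> /allP/(_ i (mem_index_enum i)) /=.
  rewrite psumr_eq0 // => /allP/(_ i' (mem_index_enum i')).
  by rewrite ii' => /eqP.
(* a function of d in {q, q.+1} agrees with its affine interpolation *)
pose f := krawt C #|S| m r.+3.
have E (I1 J1 : finType) (D1 : I1 -> J1 -> S) :
    (forall i i', i' != i ->
      coincidence D1 i i' = q \/ coincidence D1 i i' = q.+1) ->
    offdiag D1 f = offdiag D1 (fun d => (f q.+1 - f q) * d%:R +
                                        (f q - (f q.+1 - f q) * q%:R)).
  move=> t1; apply: eq_offdiag => i i' /t1.
  by case=> ->; rewrite -?(natr1 _ q); ring.
by rewrite !E // (offdiag_affine _ _ S_gt0 ssdD ssdD') subrr mulr0.
Qed.

(** * Linear forms over a finite field *)

(** The value at the point x of the linear form with coefficient vector u. *)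
Definition dot (F : finFieldType) (n : nat) (u x : 'rV[F]_n) : F :=
  \sum_i u 0 i * x 0 i.

Lemma dotE (F : finFieldType) (n : nat) (u x : 'rV[F]_n) :
  u *m x^T = (dot u x)%:M.
Proof.
apply/matrixP => i j; rewrite !ord1 !mxE eqxx mulr1n.
by apply: eq_bigr => k _; rewrite mxE.
Qed.

Lemma dot_eq0 (F : finFieldType) (n : nat) (u x : 'rV[F]_n) :
  (u *m x^T == 0) = (dot u x == 0).
Proof. by rewrite dotE -(fmorph_eq0 (@scalar_mx F 1)). Qed.

Lemma dotC (F : finFieldType) (n : nat) (u x : 'rV[F]_n) : dot u x = dot x u.
Proof. by apply: eq_bigr => i _; rewrite mulrC. Qed.

Lemma dotDr (F : finFieldType) (n : nat) (u x y : 'rV[F]_n) :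
  dot u (x + y) = dot u x + dot u y.
Proof. by rewrite -big_split; apply: eq_bigr => i _; rewrite mxE mulrDr. Qed.

Lemma dotZr (F : finFieldType) (n : nat) (u x : 'rV[F]_n) (t : F) :
  dot u (t *: x) = t * dot u x.
Proof. by rewrite mulr_sumr; apply: eq_bigr => i _; rewrite mxE mulrCA. Qed.

Lemma dotDl (F : finFieldType) (n : nat) (u v x : 'rV[F]_n) :
  dot (u + v) x = dot u x + dot v x.
Proof. by rewrite dotC dotDr !(dotC x). Qed.

Lemma dotZl (F : finFieldType) (n : nat) (u x : 'rV[F]_n) (t : F) :
  dot (t *: u) x = t * dot u x.
Proof. by rewrite dotC dotZr dotC. Qed.

Lemma dot_delta (F : finFieldType) (n : nat) (u : 'rV[F]_n) (j : 'I_n) :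
  dot u (delta_mx 0 j) = u 0 j.
Proof.
rewrite /dot (bigD1 j) //= mxE !eqxx mulr1 big1 ?addr0 // => i /negPf ij.
by rewrite mxE ij andbF mulr0.
Qed.

Lemma dot_inj (F : finFieldType) (n : nat) (u v : 'rV[F]_n) :
  dot u =1 dot v -> u = v.
Proof. by move=> uv; apply/rowP => j; rewrite -!dot_delta uv. Qed.

(** If translation by multiples of d preserves P and shifts phi by the same
    amount, then phi is uniformly distributed on P. *)
Lemma card_fibre (F : finFieldType) (n : nat) (P : {set 'rV[F]_n})
    (phi : 'rV[F]_n -> F) (d : 'rV[F]_n) (b : F) :
  (forall x t, x \in P -> x + t *: d \in P) ->
  (forall x t, x \in P -> phi (x + t *: d) = phi x + t) ->
  (#|[set x in P | phi x == b]| * #|F| = #|P|)%N.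
Proof.
move=> Pd phid.
rewrite mulnC -[LHS]sum_nat_const -[in RHS]sum1_card (partition_big phi predT) //=.
apply: eq_bigr => b' _; rewrite -sum1_card.
have shK t x : x + t *: d - t *: d = x by rewrite addrK.
rewrite (reindex_onto (fun x => x + (b - b') *: d) (fun x => x - (b - b') *: d)) /=.
  apply: eq_bigl => x; rewrite inE shK eqxx andbT.
  apply/andP/andP => -[xP /eqP xb].
    have {}xP : x \in P by rewrite -(shK (b - b') x) -scaleNr Pd.
    by split=> //; rewrite -(inj_eq (addIr (b - b'))) -phid // xb addrC subrK.
  by rewrite Pd // phid // xb addrC subrK.
by move=> x _; rewrite subrK.
Qed.

(** A form outside the span of the rows of U takes the value 1 at some point
    where all of them vanish. *)
Lemma separate (F : finFieldType) (n p : nat) (U : 'M[F]_(p, n)) (v : 'rV[F]_n) :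
  ~~ (v <= U)%MS -> exists2 d : 'rV[F]_n, U *m d^T = 0 & dot v d = 1.
Proof.
rewrite submxE => /rV0Pn[j vj].
pose a := (v *m cokermx U) 0 j; pose d0 : 'rV_n := (col j (cokermx U))^T.
have Ud : U *m d0^T = 0.
  by rewrite trmxK colE mulmxA mulmx_coker mul0mx.
have vd : dot v d0 = a by rewrite /dot /a !mxE; apply: eq_bigr => i _; rewrite !mxE.
exists (a^-1 *: d0); first by rewrite linearZ /= -scalemxAr Ud scaler0.
by rewrite dotZr vd mulVf.
Qed.

(** The common zeros of the linear forms given by the rows of U. *)
Definition zeros (F : finFieldType) (n p : nat) (U : 'M[F]_(p, n)) :
  {set 'rV[F]_n} := [set x | U *m x^T == 0].

Lemma zeros_col (F : finFieldType) (n p : nat) (U : 'M[F]_(p, n))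
    (v x : 'rV[F]_n) :
  (x \in zeros (col_mx U v)) = (x \in zeros U) && (dot v x == 0).
Proof.
by rewrite !inE mul_col_mx col_mx_eq0 dot_eq0.
Qed.

Lemma zeros_row (F : finFieldType) (n : nat) (v x : 'rV[F]_n) :
  (x \in zeros v) = (dot v x == 0).
Proof. by rewrite inE dot_eq0. Qed.

Lemma card_zeros_in (F : finFieldType) (n p : nat) (U : 'M[F]_(p, n))
    (v : 'rV[F]_n) : (v <= U)%MS -> #|zeros (col_mx U v)| = #|zeros U|.
Proof.
case/submxP => w ->; apply: eq_card => x; rewrite zeros_col.
apply: andb_idr; rewrite !inE => /eqP Ux.
by rewrite -dot_eq0 -mulmxA Ux mulmx0.
Qed.

Lemma card_zeros_notin (F : finFieldType) (n p : nat) (U : 'M[F]_(p, n))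
    (v : 'rV[F]_n) : ~~ (v <= U)%MS ->
  (#|zeros (col_mx U v)| * #|F| = #|zeros U|)%N.
Proof.
case/separate => d Ud vd.
rewrite -(@card_fibre _ _ (zeros U) (dot v) d 0).
- by congr (_ * _)%N; apply: eq_card => x; rewrite zeros_col !inE.
- move=> x t; rewrite !inE linearD linearZ /= mulmxDr -scalemxAr Ud scaler0.
  by rewrite addr0.
- by move=> x t _; rewrite dotDr dotZr vd mulr1.
Qed.

Lemma card_fibre1 (F : finFieldType) (n : nat) (v : 'rV[F]_n) (b : F) :
  v != 0 -> (#|[set x | dot v x == b]| * #|F| = #|F| ^ n)%N.
Proof.
move=> v0; have v00 : ~~ (v <= (0 : 'M[F]_n))%MS by rewrite submx0.
have [d _ vd] := separate v00.
have -> : (#|F| ^ n)%N = #|[set: 'rV[F]_n]| by rewrite cardsT card_mx mul1n.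
rewrite -(@card_fibre _ _ setT (dot v) d b) => [|x t|x t _]; last 1 first.
- by rewrite dotDr dotZr vd mulr1.
- by congr (_ * _)%N; apply: eq_card => x; rewrite !inE.
- by rewrite !inE.
Qed.

Lemma card_fibre2 (F : finFieldType) (n : nat) (u v : 'rV[F]_n) (a b : F) :
  u != 0 -> ~~ (v <= u)%MS ->
  (#|[set x | (dot u x == a) && (dot v x == b)]| * #|F| ^ 2 = #|F| ^ n)%N.
Proof.
move=> u0 /separate[d ud vd].
have {}ud : dot u d = 0 by apply/eqP; rewrite -zeros_row inE ud.
rewrite -(card_fibre1 a u0) expnS expn1 mulnA; congr (_ * _)%N.
rewrite -(@card_fibre _ _ [set x | dot u x == a] (dot v) d b).
- by congr (_ * _)%N; apply: eq_card => x; rewrite !inE.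
- by move=> x t; rewrite !inE dotDr dotZr ud mulr0 addr0.
- by move=> x t _; rewrite dotDr dotZr vd mulr1.
Qed.

(** * Normalised coefficient vectors *)

Lemma last_is_one_uniq (F : finFieldType) (p : nat) (c : 'rV[F]_p) (l l' : 'I_p) :
  last_is_one c l -> last_is_one c l' -> l = l'.
Proof.
move=> /andP[/eqP cl /forallP al] /andP[/eqP cl' /forallP al'].
apply: val_inj; case: (ltngtP l l') => // ll.
  by have := al l'; rewrite ll cl' oner_eq0.
by have := al' l; rewrite ll cl oner_eq0.
Qed.

(** The nonzero vectors whose last nonzero entry is 1: one representative of
    each point of the projective space. *)
Definition normalised (F : finFieldType) (n : nat) : {set 'rV[F]_n} :=
  [set c | [exists l, last_is_one c l]].
Arguments normalised F n : clear implicits.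

Lemma normalised_neq0 (F : finFieldType) (n : nat) (c : 'rV[F]_n) :
  c \in normalised F n -> c != 0.
Proof.
rewrite inE => /existsP[l /andP[/eqP cl _]].
by apply: contra_eq_neq cl => ->; rewrite mxE eq_sym oner_eq0.
Qed.

Lemma normalised_scale (F : finFieldType) (n : nat) (c : 'rV[F]_n) (t : F) :
  c \in normalised F n -> t *: c \in normalised F n -> t = 1.
Proof.
rewrite !inE => /existsP[l lc] /existsP[l' /andP[/eqP tl' /forallP al']].
have t0 : t != 0.
  by apply: contra_eq_neq tl' => ->; rewrite scale0r mxE eq_sym oner_eq0.
have [/eqP cl /forallP al] := andP lc.
rewrite mxE in tl'; suff e : l = l' by rewrite -tl' -e cl mulr1.
apply: val_inj; case: (ltngtP l l') => // ll.
  by have := al l'; rewrite ll /= => /eqP e; rewrite e mulr0 in tl';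
     move/eqP: tl'; rewrite eq_sym oner_eq0.
by have := al' l; rewrite ll mxE cl mulr1 (negPf t0).
Qed.

Lemma normaliseP (F : finFieldType) (n : nat) (v : 'rV[F]_n) : v != 0 ->
  exists2 t, t != 0 & t *: v \in normalised F n.
Proof.
case/rV0Pn => i vi.
case: (@arg_maxnP _ i (fun j => v 0 j != 0) (fun j => j)) => // l vl ml.
exists (v 0 l)^-1; first by rewrite invr_eq0.
rewrite inE; apply/existsP; exists l; apply/andP; split.
  by rewrite mxE mulVf.
apply/forallP => j; apply/implyP => lj; rewrite mxE mulf_eq0.
by have [_|/ml] := eqVneq (v 0 j) 0; [rewrite orbT | rewrite /= leqNgt lj].
Qed.

(** A set of nonzero vectors closed under scaling has s - 1 times as many
    elements as normalised elements. *)
Lemma card_normalised (F : finFieldType) (n : nat) (T : {set 'rV[F]_n}) :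
  0 \notin T -> (forall t v, t != 0 -> v \in T -> t *: v \in T) ->
  (#|[set c in normalised F n | c \in T]| * (#|F| - 1) = #|T|)%N.
Proof.
move=> T0 TZ; set A := [set c in _ | _].
pose f (p : F * 'rV[F]_n) := p.1 *: p.2.
have F1 : (#|F| - 1)%N = #|[set~ (0 : F)]| by rewrite cardsC1 subn1.
rewrite F1 mulnC -cardsX -(@card_in_imset _ _ f).
  apply: eq_card => v; apply/imsetP/idP => [[[t c]]|vT].
    by rewrite !inE /= => /andP[t0 /andP[_ cT]] ->; apply: TZ.
  have v0 : v != 0 by apply: contraNneq T0 => <-.
  have [t t0 tv] := normaliseP v0.
  exists (t^-1, t *: v); last by rewrite /f /= scalerK.
  by rewrite !inE /= invr_eq0 t0; move: tv; rewrite !inE => ->; apply: TZ.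
move=> [t c] [t' c']; rewrite !inE /f /= => /andP[t0 /andP[cN _]].
move=> /andP[t'0 /andP[c'N _]] e.
have e' : c' = (t'^-1 * t) *: c by rewrite -scalerA e scalerK.
have cN' : c \in normalised F n by rewrite inE.
have t1 : t'^-1 * t = 1.
  by apply: (normalised_scale cN'); rewrite -e' inE.
have -> : t = t' by rewrite -[t](mulVKf t'0) t1 mulr1.
by rewrite e' t1 scale1r.
Qed.

(** The normalised linear forms in which the variable of index l is absent. *)
Definition normalised_without (F : finFieldType) (n : nat) (l : 'I_n) :
  {set 'rV[F]_n} := [set e in normalised F n | e 0 l == 0].
Arguments normalised_without F {n} l.

Lemma delta_neq0 (F : finFieldType) (n : nat) (l : 'I_n) :
  delta_mx 0 l != 0 :> 'rV[F]_n.
Proof.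
by apply/rV0Pn; exists l; rewrite mxE !eqxx oner_eq0.
Qed.

Lemma card_zeros_row (F : finFieldType) (n : nat) (v : 'rV[F]_n) : v != 0 ->
  #|zeros v| = (#|F| ^ n.-1)%N.
Proof.
case: n v => [|n] v v0; first by rewrite thinmx0 eqxx in v0.
apply/eqP; rewrite -(eqn_pmul2r (ltnW (card_finNzRing_gt1 F))) -expnSr.
rewrite -(card_fibre1 0 v0); apply/eqP; congr (_ * _)%N.
by apply: eq_card => x; rewrite zeros_row inE.
Qed.

Lemma card_normalised_zeros (F : finFieldType) (n p : nat) (U : 'M[F]_(p, n)) :
  (#|[set c in normalised F n | c \in zeros U]| * (#|F| - 1) = #|zeros U| - 1)%N.
Proof.
have -> : (#|zeros U| - 1)%N = #|zeros U :\ 0|.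
  by rewrite (cardsD1 0 (zeros U)) inE linear0 mulmx0 eqxx add1n subn1.
rewrite -(@card_normalised _ _ (zeros U :\ 0)).
- congr (_ * _)%N; apply: eq_card => c; rewrite in_set [in RHS]in_set in_setD1.
  by have [/normalised_neq0 ->|] := boolP (c \in normalised F n).
- by rewrite !inE eqxx.
- move=> t v t0; rewrite !in_setD1 !in_set scaler_eq0 (negPf t0) /=.
  by move=> /andP[-> /eqP Uv]; rewrite linearZ /= -scalemxAr Uv scaler0 eqxx.
Qed.

Lemma card_normalised_without (F : finFieldType) (n : nat) (l : 'I_n) :
  (#|normalised_without F l| * (#|F| - 1) = #|F| ^ n.-1 - 1)%N.
Proof.
rewrite -(card_zeros_row (delta_neq0 F l)) -card_normalised_zeros.
congr (_ * _)%N; apply: eq_card => c.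
by rewrite [LHS]in_set [RHS]in_set zeros_row dotC dot_delta.
Qed.

(** * Quadratic columns *)

(** The column of the function h^2 + L, where c and L are the coefficient
    vectors of the linear forms h and L. *)
Definition qcol (F : finFieldType) (n : nat) (c L : 'rV[F]_n) : column F n :=
  [ffun x => dot c x ^+ 2 + dot L x].

Lemma qcol_inj (F : finFieldType) (n : nat) (c : 'rV[F]_n) : injective (qcol c).
Proof.
move=> L L' /ffunP e; apply: dot_inj => x.
by have := e x; rewrite !ffunE => /addrI.
Qed.

Lemma qcol_shift (F : finFieldType) (n : nat) (c L y d : 'rV[F]_n) :
  qcol c L (y + d) =
  qcol c L y + (2 * dot c d * dot c y + (dot c d ^+ 2 + dot L d)).
Proof. by rewrite !ffunE !dotDr; ring. Qed.

(** Agreement of a column at y and y + d: a condition on d alone if the squared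
    form vanishes at d, and otherwise one linear equation for y. *)
Lemma qcol_agree0 (F : finFieldType) (n : nat) (c L y d : 'rV[F]_n) :
  dot c d = 0 -> (qcol c L (y + d) == qcol c L y) = (dot L d == 0).
Proof.
move=> cd; rewrite qcol_shift cd mulr0 mul0r expr0n /= !add0r.
by rewrite -subr_eq0 addrC addKr.
Qed.

Lemma qcol_agree (F : finFieldType) (n : nat) (c L d : 'rV[F]_n) :
  2 != 0 :> F -> dot c d != 0 -> exists b, forall y,
  (qcol c L (y + d) == qcol c L y) = (dot c y == b).
Proof.
move=> F2 cd; exists (- (dot c d ^+ 2 + dot L d) / (2 * dot c d)) => y.
have cd2 : 2 * dot c d != 0 by rewrite mulf_neq0.
rewrite qcol_shift -subr_eq0 addrC addKr addr_eq0.
by rewrite -[RHS](inj_eq (mulfI cd2)) [2 * _ * (_ / _)]mulrCA mulfV // mulr1.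
Qed.

(** A column h^2 + L with L not a multiple of h is balanced: there is a
    direction along which h is constant and L runs through all symbols. *)
Lemma qcol_balanced (F : finFieldType) (n : nat) (c L : 'rV[F]_n) (v : F) :
  ~~ (L <= c)%MS -> (#|[set x | qcol c L x == v]| * #|F| = #|F| ^ n)%N.
Proof.
case/separate=> d /eqP; rewrite dot_eq0 => /eqP cd Ld.
have -> : (#|F| ^ n)%N = #|[set: 'rV[F]_n]| by rewrite cardsT card_mx mul1n.
rewrite -(@card_fibre _ _ setT (qcol c L) d v) => [|x t|x t _].
- by congr (_ * _)%N; apply: eq_card => x; rewrite !inE.
- by rewrite !inE.
- by rewrite !ffunE !dotDr !dotZr cd Ld mulr0 mulr1 addr0 addrA.
Qed.

Lemma sum_indicator (R : pzRingType) (I : finType) (P : pred I) :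
  \sum_x (P x)%:R = #|[set x | P x]|%:R :> R.
Proof.
rewrite -sum1dep_card natr_sum [RHS]big_mkcond; apply: eq_bigr => x _ /=.
by case: (P x).
Qed.

(** The projected A_2 value of a pair of columns, written without contrasts. *)
Definition pairA2 (R : numFieldType) (S I : finType) (f g : I -> S) : R :=
  #|I|%:R ^- 2 * \sum_x \sum_y
    (#|S|%:R * (f x == f y)%:R - 1) * (#|S|%:R * (g x == g y)%:R - 1).

(** For balanced columns the projected value is determined by the number of
    pairs of rows in which both columns agree. *)
Lemma pairA2_balanced (R : numFieldType) (S I : finType) (f g : I -> S) :
  (0 < #|I|)%N ->
  (forall v, #|[set x | f x == v]| * #|S| = #|I|)%N ->
  (forall v, #|[set x | g x == v]| * #|S| = #|I|)%N ->
  pairA2 R f g = #|S|%:R ^+ 2 / #|I|%:R ^+ 2 *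
     (\sum_x #|[set y | (f y == f x) && (g y == g x)]|)%:R - 1.
Proof.
move=> I_gt0 balf balg.
have I0 : #|I|%:R != 0 :> R by rewrite pnatr_eq0 -lt0n.
have bal (k : I -> S) x : (forall v, #|[set x | k x == v]| * #|S| = #|I|)%N ->
    \sum_y #|S|%:R * (k x == k y)%:R = #|I|%:R :> R.
  move=> balk; rewrite -mulr_sumr sum_indicator -natrM -(balk (k x)).
  by rewrite mulnC; congr (_ * _)%:R; apply: eq_card => y; rewrite !inE eq_sym.
have E x : \sum_y (#|S|%:R * (f x == f y)%:R - 1) *
    (#|S|%:R * (g x == g y)%:R - 1) = #|S|%:R ^+ 2 *
      #|[set y | (f y == f x) && (g y == g x)]|%:R - #|I|%:R :> R.
  transitivity (#|S|%:R ^+ 2 * (\sum_y ((f y == f x) && (g y == g x))%:R)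
    - \sum_y #|S|%:R * (f x == f y)%:R - \sum_y #|S|%:R * (g x == g y)%:R
    + \sum_(y : I) 1 :> R).
    rewrite mulr_sumr -!sumrB -big_split; apply: eq_bigr => y _ /=.
    by rewrite (eq_sym (f y)) (eq_sym (g y)); do 2!case: eqP => _ /=; ring.
  by rewrite sum_indicator !bal // sumr_const; ring.
rewrite /pairA2 (eq_bigr _ (fun x _ => E x)) sumrB -mulr_sumr -natr_sum.
rewrite sumr_const -[_ *+ _]mulr_natl.
by field.
Qed.

Lemma pairA2_uniform (R : numFieldType) (S I : finType) (f g : I -> S) (t : R) :
  (0 < #|I|)%N ->
  (forall v, #|[set x | f x == v]| * #|S| = #|I|)%N ->
  (forall v, #|[set x | g x == v]| * #|S| = #|I|)%N ->
  (forall x, #|[set y | (f y == f x) && (g y == g x)]|%:R = t * #|I|%:R) ->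
  pairA2 R f g = #|S|%:R ^+ 2 * t - 1.
Proof.
move=> I_gt0 balf balg agr; rewrite pairA2_balanced // natr_sum.
have I0 : #|I|%:R != 0 :> R by rewrite pnatr_eq0 -lt0n.
under eq_bigr do rewrite agr; rewrite sumr_const -mulr_natl; congr (_ - _).
by field.
Qed.

(** Pairs of rows x, y are listed by y and the difference d = x - y. *)
Lemma sum_agree_shift (F : finFieldType) (n : nat) (f g : 'rV[F]_n -> F) :
  (\sum_x #|[set y | (f y == f x) && (g y == g x)]| =
   \sum_d #|[set y | (f (y + d)%R == f y) && (g (y + d)%R == g y)]|)%N.
Proof.
under eq_bigr do rewrite -sum1dep_card big_mkcond.
under [RHS]eq_bigr do rewrite -sum1dep_card big_mkcond.
rewrite exchange_big [RHS]exchange_big; apply: eq_bigr => y _ /=.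
rewrite (reindex (+%R y)) /=.
  by apply: eq_bigr => d _; rewrite (eq_sym (f y)) (eq_sym (g y)).
by exists (fun x => x - y) => x _; rewrite ?addrNK // addrC ?addKr ?addNKr ?addrNK.
Qed.

Lemma col_mx_rowP (F : fieldType) (n : nat) (u w v : 'rV[F]_n) :
  reflect (exists a b, v = a *: u + b *: w) (v <= col_mx u w)%MS.
Proof.
rewrite -(addsmxE u w).
apply: (iffP sub_addsmxP) => [[[a b] /= ->]|[a [b ->]]].
  exists (a 0 0), (b 0 0).
  by rewrite {1}[a]mx11_scalar {1}[b]mx11_scalar !mul_scalar_mx.
by exists (a%:M, b%:M); rewrite !mul_scalar_mx.
Qed.

Lemma sub_col_mxC (F : fieldType) (n : nat) (u w v : 'rV[F]_n) :
  (v <= col_mx u w)%MS = (v <= col_mx w u)%MS.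
Proof.
by apply/col_mx_rowP/col_mx_rowP => -[a [b ->]]; exists b, a; rewrite addrC.
Qed.

(** The proportion of points at which all linear forms given by U vanish. *)
Definition zero_freq (R : numFieldType) (F : finFieldType) (n p : nat)
    (U : 'M[F]_(p, n)) : R := #|zeros U|%:R / #|F|%:R ^+ n.

Lemma field_card_neq0 (R : numFieldType) (F : finFieldType) : #|F|%:R != 0 :> R.
Proof. by rewrite pnatr_eq0 -lt0n ltnW // card_finNzRing_gt1. Qed.
Arguments field_card_neq0 : clear implicits.

Lemma zero_freq_in (R : numFieldType) (F : finFieldType) (n p : nat)
    (U : 'M[F]_(p, n)) (v : 'rV[F]_n) : (v <= U)%MS ->
  zero_freq R (col_mx U v) = zero_freq R U.
Proof. by move=> vU; rewrite /zero_freq card_zeros_in. Qed.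

Lemma zero_freq_notin (R : numFieldType) (F : finFieldType) (n p : nat)
    (U : 'M[F]_(p, n)) (v : 'rV[F]_n) : ~~ (v <= U)%MS ->
  zero_freq R (col_mx U v) = zero_freq R U / #|F|%:R.
Proof.
move=> vU; rewrite /zero_freq -(card_zeros_notin vU) natrM.
rewrite [X in _ = X / _]mulrAC mulfK //; exact: field_card_neq0.
Qed.

Lemma zero_freq_row (R : numFieldType) (F : finFieldType) (n : nat)
    (v : 'rV[F]_n) : v != 0 -> zero_freq R v = #|F|%:R^-1.
Proof.
case: n v => [|n] v v0; first by rewrite thinmx0 eqxx in v0.
rewrite /zero_freq card_zeros_row // natrX exprS invfM mulrA mulrAC mulfV ?mul1r //.
by rewrite expf_neq0 // field_card_neq0.
Qed.

Lemma sum_zeros (R : numFieldType) (F : finFieldType) (n p : nat)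
    (U : 'M[F]_(p, n)) :
  \sum_d (d \in zeros U)%:R = zero_freq R U * #|F|%:R ^+ n.
Proof.
rewrite /zero_freq divfK ?expf_neq0 ?field_card_neq0 // sum_indicator.
by congr _%:R; apply: eq_card => d; rewrite in_set.
Qed.

Lemma natr_card_fibre1 (R : numFieldType) (F : finFieldType) (n : nat)
    (v : 'rV[F]_n) (b : F) : v != 0 ->
  #|[set x | dot v x == b]|%:R = #|F|%:R ^+ n / #|F|%:R :> R.
Proof.
move=> v0; rewrite -natrX -(card_fibre1 b v0) natrM mulfK //.
exact: field_card_neq0.
Qed.

Lemma natr_card_fibre2 (R : numFieldType) (F : finFieldType) (n : nat)
    (u v : 'rV[F]_n) (a b : F) : u != 0 -> ~~ (v <= u)%MS ->
  #|[set x | (dot u x == a) && (dot v x == b)]|%:R =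
    #|F|%:R ^+ n / #|F|%:R ^+ 2 :> R.
Proof.
move=> u0 vu; rewrite -natrX -(card_fibre2 a b u0 vu) natrM natrX mulfK //.
by rewrite expf_neq0 // field_card_neq0.
Qed.

(** The number of points y such that both columns agree at y and y + d. For
    each column this is a linear equation in y when the squared form does not
    vanish at d, and a condition on d alone otherwise. *)
Lemma card_agree_shift (R : numFieldType) (F : finFieldType) (n : nat)
    (c1 c2 L1 L2 d : 'rV[F]_n) :
  2 != 0 :> F -> c1 != 0 -> c2 != 0 -> ~~ (c2 <= c1)%MS ->
  let W := col_mx c1 c2 in
  let s : R := #|F|%:R in
  let z p (U : 'M_(p, n)) : R := (d \in zeros U)%:R in
  #|[set y | (qcol c1 L1 (y + d) == qcol c1 L1 y) &&
             (qcol c2 L2 (y + d) == qcol c2 L2 y)]|%:R =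
  s ^+ n * (s ^- 2 * (1 - z 1%N c1 - z 1%N c2 + z _ W)
            + s^-1 * (z _ (col_mx c2 L2) - z _ (col_mx W L2)
                      + z _ (col_mx c1 L1) - z _ (col_mx W L1))
            + z _ (col_mx (col_mx W L1) L2)).
Proof.
move=> F2 c10 c20 c21 W s z; rewrite /z !zeros_col !zeros_row.
have [e1|e1] := eqVneq (dot c1 d) 0; have [e2|e2] := eqVneq (dot c2 d) 0 => /=.
- rewrite (_ : [set y | _] = if (dot L1 d == 0) && (dot L2 d == 0) then setT else set0).
    case: eqP => _; case: eqP => _ /=; rewrite ?cards0 ?cardsT ?card_mx ?mul1n ?natrX;
    rewrite /s; ring.
  apply/setP => y; rewrite inE !qcol_agree0 //.
  by do 2!case: eqP => _; rewrite inE.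
- have [b bP] := qcol_agree L2 F2 e2.
  rewrite (_ : [set y | _] = if dot L1 d == 0 then [set y | dot c2 y == b] else set0).
    case: eqP => _ /=; rewrite ?cards0 ?natr_card_fibre1 // -/s; ring.
  apply/setP => y; rewrite inE qcol_agree0 // bP.
  by case: eqP => _; rewrite inE.
- have [b bP] := qcol_agree L1 F2 e1.
  rewrite (_ : [set y | _] = if dot L2 d == 0 then [set y | dot c1 y == b] else set0).
    case: eqP => _ /=; rewrite ?cards0 ?natr_card_fibre1 // -/s; ring.
  apply/setP => y; rewrite inE (qcol_agree0 L2) // bP.
  by case: (dot L2 d == 0); rewrite inE ?andbT ?andbF.
- have [b1 b1P] := qcol_agree L1 F2 e1; have [b2 b2P] := qcol_agree L2 F2 e2.
  rewrite (_ : [set y | _] = [set y | (dot c1 y == b1) && (dot c2 y == b2)]).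
    by rewrite natr_card_fibre2 // -/s; ring.
  by apply/setP => y; rewrite !inE b1P b2P.
Qed.

(** Summing over d expresses the projected value through the sizes of the
    spaces of common zeros of the linear forms involved. *)
Lemma pairA2_freq (R : numFieldType) (F : finFieldType) (n : nat)
    (c1 c2 L1 L2 : 'rV[F]_n) :
  2 != 0 :> F -> c1 != 0 -> c2 != 0 -> ~~ (c2 <= c1)%MS ->
  ~~ (L1 <= c1)%MS -> ~~ (L2 <= c2)%MS ->
  let W := col_mx c1 c2 in
  let s : R := #|F|%:R in
  pairA2 R (qcol c1 L1) (qcol c2 L2) =
  s ^+ 2 * (s ^- 2 * (1 - 2 / s + s ^- 2) +
     s^-1 * (2 * s ^- 2 - zero_freq R (col_mx W L1) - zero_freq R (col_mx W L2))
     + zero_freq R (col_mx (col_mx W L1) L2)) - 1.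
Proof.
move=> F2 c10 c20 c21 L1c L2c W s.
have cI : #|'rV[F]_n| = (#|F| ^ n)%N by rewrite card_mx mul1n.
have s0 : s != 0 by exact: field_card_neq0.
have cI0 : (0 < #|'rV[F]_n|)%N.
  by rewrite cI expn_gt0 ltnW // card_finNzRing_gt1.
have bal (c L : 'rV[F]_n) (Lc : ~~ (L <= c)%MS) v :
    (#|[set x | qcol c L x == v]| * #|F| = #|'rV[F]_n|)%N.
  by rewrite cI qcol_balanced.
rewrite pairA2_balanced //; try exact: bal.
rewrite sum_agree_shift natr_sum.
under eq_bigr do rewrite card_agree_shift //.
rewrite -mulr_sumr !(big_split, sumrN) /= -!mulr_sumr.
rewrite !(big_split, sumrN) /= !sum_zeros !zero_freq_row //.
rewrite (zero_freq_notin _ c21) (zero_freq_notin _ L1c) (zero_freq_notin _ L2c).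
rewrite !zero_freq_row //.
rewrite sumr_const cI natrX -/s -/W.
by field; rewrite s0 expf_neq0.
Qed.

(** * Pairs of quadratic columns *)

Lemma odd_field_two_neq0 (F : finFieldType) : odd #|F| -> 2 != 0 :> F.
Proof.
move=> oddF; apply/eqP => F2.
(* summing x + 1 over all x gives the same total as summing x *)
have /eqP : (#|F|%:R : F) = 0.
  apply: (addrI (\sum_(x : F) x)); rewrite addr0 -sumr_const -big_split.
  by rewrite [RHS](reindex_inj (addIr 1)).
rewrite -(odd_double_half #|F|) oddF mulrnDr -muln2 mulnC mulrnA F2 mul0rn addr0.
by rewrite oner_eq0.
Qed.

Lemma normalised_notin (F : finFieldType) (n : nat) (c c' : 'rV[F]_n) :
  c \in normalised F n -> c' \in normalised F n -> c != c' -> ~~ (c' <= c)%MS.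
Proof.
move=> cN c'N; apply: contra => /sub_rVP[t c'E]; apply/eqP.
by rewrite c'E in c'N *; rewrite (normalised_scale cN c'N) scale1r.
Qed.

Lemma last_is_one_normalised (F : finFieldType) (n : nat) (c : 'rV[F]_n) l :
  last_is_one c l -> c \in normalised F n.
Proof. by move=> cl; rewrite inE; apply/existsP; exists l. Qed.

(** The linear part of a column is never a multiple of the squared form. *)
Lemma family_form_notin (F : finFieldType) (n : nat) (c e : 'rV[F]_n) (l : 'I_n)
    (a : F) :
  last_is_one c l -> e \in normalised_without F l -> ~~ ((a *: c + e)%R <= c)%MS.
Proof.
case/andP=> /eqP cl _; rewrite in_set => /andP[eN /eqP el].
apply/negP => /sub_rVP[t E]; have := congr1 (fun v : 'rV_n => v 0 l) E.
rewrite !mxE cl el addr0 !mulr1 => at_; have /negP[] := normalised_neq0 eN.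
by apply/eqP/(addrI (a *: c)); rewrite E at_ addr0.
Qed.

(** Two distinct columns h^2 + a h + g and h^2 + a' h + g' are orthogonal. If g and
    g' differ, some direction fixes h and g and moves the second column through
    all symbols. If g = g', the difference of the columns is a nonzero multiple of
    h, and some direction fixes h and moves the first column through all symbols. *)
Lemma pairA2_same (R : numFieldType) (F : finFieldType) (n : nat)
    (c e e' : 'rV[F]_n) (l : 'I_n) (a a' : F) :
  last_is_one c l -> e \in normalised_without F l ->
  e' \in normalised_without F l -> (a, e) != (a', e') ->
  pairA2 R (qcol c (a *: c + e)) (qcol c (a' *: c + e')) = 0.
Proof.
move=> cl eE e'E ne.
have s0 := field_card_neq0 R F.
have cI : #|'rV[F]_n| = (#|F| ^ n)%N by rewrite card_mx mul1n.
have cI0 : (0 < #|'rV[F]_n|)%N.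
  by rewrite cI expn_gt0 ltnW // card_finNzRing_gt1.
have cN := last_is_one_normalised cl; have c0 := normalised_neq0 cN.
have bal b e1 (e1E : e1 \in normalised_without F l) v :
    (#|[set x | qcol c (b *: c + e1) x == v]| * #|F| = #|'rV[F]_n|)%N.
  by rewrite cI qcol_balanced // (family_form_notin _ cl).
suff agr x : #|[set y | (qcol c (a *: c + e) y == qcol c (a *: c + e) x) &&
    (qcol c (a' *: c + e') y == qcol c (a' *: c + e') x)]|%:R =
    #|F|%:R ^- 2 * #|'rV[F]_n|%:R :> R.
  rewrite (pairA2_uniform cI0 _ _ agr); try exact: bal.
  by field.
set A := [set y | _].
suff E : (#|A| * #|F| * #|F| = #|'rV[F]_n|)%N.
  by rewrite -E !natrM; field.
have [ee|ee] := eqVneq e e'.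
  have aa : a != a' by apply: contraNneq ne => ->; rewrite ee.
  (* the difference of the two columns is a nonzero multiple of h *)
  have AE : A = [set y in [set z | dot c z == dot c x] |
                 qcol c (a *: c + e) y == qcol c (a *: c + e) x].
    apply/setP => y; rewrite !inE andbC; apply: andb_id2r => /eqP fE.
    have fE' : qcol c (a' *: c + e') y = qcol c (a *: c + e) y + (a' - a) * dot c y.
      by rewrite !ffunE !dotDl !dotZl ee; ring.
    have fE'x : qcol c (a' *: c + e') x = qcol c (a *: c + e) x + (a' - a) * dot c x.
      by rewrite !ffunE !dotDl !dotZl ee; ring.
    rewrite fE' fE'x fE (inj_eq (addrI _)) (inj_eq (mulfI _)) //.
    by rewrite subr_eq0 eq_sym.
  have /separate[d /eqP] := family_form_notin 0 cl eE.
  rewrite scale0r add0r dot_eq0 => /eqP cd ed.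
  rewrite AE (@card_fibre _ _ _ _ d) => [|y t|y t _].
  - by rewrite cI -(card_fibre1 (dot c x) c0).
  - by rewrite !inE dotDr dotZr cd mulr0 addr0.
  - by rewrite !ffunE !dotDr !dotDl !dotZr !dotZl cd ed; ring.
have [e'N /eqP e'l] : e' \in normalised F n /\ e' 0 l == 0.
  by move: e'E; rewrite in_set => /andP.
have [eN /eqP el] : e \in normalised F n /\ e 0 l == 0.
  by move: eE; rewrite in_set => /andP.
have /separate[d Ud e'd] : ~~ (e' <= col_mx c e)%MS.
  apply/negP => /col_mx_rowP[t [r E]].
  have /andP[/eqP cl1 _] := cl.
  have := congr1 (fun v : 'rV_n => v 0 l) E.
  rewrite !mxE cl1 el e'l mulr0 mulr1 addr0 => t0.
  rewrite -t0 scale0r add0r in E.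
  by have /negP[] := normalised_notin eN e'N ee; rewrite E scalemx_sub.
have /andP[/eqP cd /eqP ed] : (dot c d == 0) && (dot e d == 0).
  by rewrite -zeros_row -zeros_col inE Ud.
have -> : A = [set y in [set z | qcol c (a *: c + e) z == qcol c (a *: c + e) x] |
   qcol c (a' *: c + e') y == qcol c (a' *: c + e') x].
  by apply/setP => y; rewrite !inE.
rewrite (@card_fibre _ _ _ _ d) => [|y t|y t _]; first exact: bal.
- by rewrite !inE !ffunE !dotDr !dotDl !dotZr !dotZl cd ed !mulr0 !addr0.
- by rewrite !ffunE !dotDr !dotDl !dotZr !dotZl cd e'd; ring.
Qed.

(** For distinct squared forms, spanning the plane W, the value depends on the
    position of the two linear parts modulo W: both zero, both nonzero and
    proportional, or anything else. *)
Lemma pairA2_diff (R : numFieldType) (F : finFieldType) (n : nat)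
    (c c' L L' : 'rV[F]_n) :
  2 != 0 :> F -> c \in normalised F n -> c' \in normalised F n -> c != c' ->
  ~~ (L <= c)%MS -> ~~ (L' <= c')%MS ->
  let W := col_mx c c' in
  let s : R := #|F|%:R in
  pairA2 R (qcol c L) (qcol c' L') =
    if (L <= W)%MS && (L' <= W)%MS then (s - 1) ^+ 2 / s ^+ 2
    else if [&& ~~ (L <= W)%MS, ~~ (L' <= W)%MS & (L' <= col_mx W L)%MS]
         then (s - 1) / s ^+ 2
    else 0.
Proof.
move=> F2 cN c'N cc' Lc Lc' W s.
have c'c := normalised_notin cN c'N cc'.
have c0 := normalised_neq0 cN; have c'0 := normalised_neq0 c'N.
have s0 : s != 0 by exact: field_card_neq0.
have fW : zero_freq R W = s^-1 / s.
  by rewrite (zero_freq_notin _ c'c) zero_freq_row.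
rewrite pairA2_freq // -/W -/s.
have /andP[sub_L _] : (W <= col_mx W L)%MS && (L <= col_mx W L)%MS.
  by rewrite -col_mx_sub submx_refl.
have [LW|LW] := boolP (L <= W)%MS; have [L'W|L'W] := boolP (L' <= W)%MS => /=.
- rewrite (zero_freq_in _ (submx_trans L'W sub_L)) (zero_freq_in _ LW).
  rewrite (zero_freq_in _ L'W) fW.
  by field.
- have L'WL : ~~ (L' <= col_mx W L)%MS.
    by apply: contra L'W => /submx_trans; apply; rewrite col_mx_sub submx_refl.
  rewrite (zero_freq_notin _ L'WL) (zero_freq_notin _ L'W).
  rewrite (zero_freq_in _ LW) fW.
  by field.
- rewrite (zero_freq_in _ (submx_trans L'W sub_L)) (zero_freq_notin _ LW).
  by rewrite (zero_freq_in _ L'W) fW; field.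
- have [L'WL|L'WL] := boolP (L' <= col_mx W L)%MS.
    rewrite (zero_freq_in _ L'WL) (zero_freq_notin _ LW) (zero_freq_notin _ L'W) fW.
    by field.
  rewrite (zero_freq_notin _ L'WL) (zero_freq_notin _ LW) (zero_freq_notin _ L'W).
  by rewrite fW; field.
Qed.

(** A plane of linear forms containing a form c whose coefficient of index l is
    1 contains exactly one normalised form without that variable. *)
Lemma unique_normalised_in_plane (F : finFieldType) (n : nat) (c c' : 'rV[F]_n)
    (l : 'I_n) : last_is_one c l -> c' \in normalised F n -> c != c' ->
  #|[set e in normalised_without F l | (e <= col_mx c c')%MS]| = 1%N.
Proof.
move=> cl c'N cc'; have cN := last_is_one_normalised cl.
have /andP[/eqP cl1 _] := cl.
(* the forms of the plane without the variable of index l are the multiples of w *)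
pose w := c' - c' 0 l *: c.
have wl : w 0 l = 0 by rewrite !mxE cl1 mulr1 subrr.
have w0 : w != 0.
  apply: contraNneq (normalised_notin cN c'N cc') => /eqP.
  by rewrite subr_eq0 => /eqP ->; rewrite scalemx_sub.
have [t t0 twN] := normaliseP w0.
apply/eqP/cards1P; exists (t *: w); apply/setP => e; rewrite in_set in_set1 in_set.
apply/idP/eqP => [/andP[/andP[eN /eqP el] /col_mx_rowP[a [b eE]]]|->].
  have := congr1 (fun v : 'rV_n => v 0 l) eE.
  rewrite !mxE cl1 el mulr1 => /esym/eqP; rewrite addr_eq0 => /eqP aE.
  have {}eE : e = (b / t) *: (t *: w).
    rewrite scalerA divfK // eE aE scalerBr scalerA addrC; congr (_ + _).
    by rewrite scaleNr.
  by rewrite eE in eN *; rewrite (normalised_scale twN eN) scale1r.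
rewrite twN mxE wl mulr0 eqxx; apply/col_mx_rowP; exists (- (t * c' 0 l)), t.
by rewrite /w scalerBr addrC scaleNr scalerA.
Qed.

(** Within one family, the number of columns that agree at x and y depends only
    on whether the squared form takes the same value at x and y. If it does not,
    each g determines exactly one a; if it does, a is free and g must vanish at
    x - y, which leaves one column less. *)
Lemma card_agree_family (F : finFieldType) (n : nat) (c x y : 'rV[F]_n)
    (l : 'I_n) : last_is_one c l -> x != y ->
  ((\sum_(a : F) \sum_(e in normalised_without F l)
     (qcol c (a *: c + e) x == qcol c (a *: c + e) y)) + (dot c x == dot c y) =
  #|normalised_without F l|)%N.
Proof.
move=> cl xy; pose d := x - y; have xE : x = y + d by rewrite addrC subrK.
have d0 : d != 0 by rewrite subr_eq0.
have -> : (dot c x == dot c y) = (dot c d == 0).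
  by rewrite xE dotDr -subr_eq0 addrC addKr.
rewrite xE; have [cd|cd] := eqVneq (dot c d) 0; last first.
  rewrite addn0 exchange_big -sum1_card; apply: eq_bigr => e _.
  pose K := 2 * dot c d * dot c y + (dot c d ^+ 2 + dot e d).
  rewrite (bigD1 (- K / dot c d)) //= big1 => [|a /negPf aK].
    rewrite qcol_shift dotDl dotZl divfK //.
    rewrite (_ : _ + _ = qcol c (- K / dot c d *: c + e) y) ?eqxx //.
    by rewrite /K; ring.
  rewrite qcol_shift dotDl dotZl -subr_eq0 addrC addKr.
  rewrite (_ : _ + _ = a * dot c d + K); last by rewrite /K; ring.
  by rewrite addr_eq0 -(inj_eq (mulIf (invr_neq0 cd))) mulfK // aK.
have cl1 : c 0 l = 1 by case/andP: cl => /eqP.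
have s1 := card_finNzRing_gt1 F.
have lz : ~~ (d <= (delta_mx 0 l : 'rV_n))%MS.
  apply: contraNN d0 => /sub_rVP[t dE]; move: cd; rewrite dE dotZr dot_delta cl1.
  by rewrite mulr1 => ->; rewrite scale0r.
have := card_zeros_notin lz; rewrite card_zeros_row ?delta_neq0 //.
have := card_normalised_zeros (col_mx (delta_mx 0 l) d).
have := card_normalised_without F l.
pose M' := #|[set b in normalised F n | b \in zeros (col_mx (delta_mx 0 l : 'rV_n) d)]|.
rewrite -/M'; set M := #|normalised_without F l|; set Z := #|zeros _|.
have -> : (\sum_a \sum_(e in normalised_without F l)
   (qcol c (a *: c + e) (y + d)%R == qcol c (a *: c + e) y) = #|F| * M')%N.
  rewrite -sum_nat_const; apply: eq_bigr => a _.
  rewrite /M' -sum1_card big_mkcond [RHS]big_mkcond; apply: eq_bigr => e _.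
  rewrite qcol_agree0 // dotDl dotZl cd mulr0 add0r.
  rewrite !in_set mul_col_mx col_mx_eq0 !dot_eq0 !(dotC _ e) dot_delta andbA.
  by case: ([exists _, _] && _); case: (dot e d == 0).
move=> EM EM' EZ; rewrite addn1; apply/eqP.
have s1' : (0 < #|F| - 1)%N by rewrite subn_gt0.
rewrite -(eqn_pmul2r s1') EM mulSn -mulnA EM' mulnBr muln1 mulnC EZ.
have : (#|F| <= #|F| ^ n.-1)%N.
  rewrite -EZ leq_pmull // lt0n; apply: contraTneq (ltn_trans (ltnSn 0) s1) => Z0.
  by move: EZ; rewrite Z0 mul0n => /esym/eqP; rewrite expn_eq0 => /andP[/eqP ->].
move: (#|F| ^ n.-1)%N => u; move: #|F| s1 => [|[|f]] // _ le_u.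
by rewrite !subSS subn0 -(subnK le_u) addnK addnS subSS subn0 addnC.
Qed.

(** * Projections onto pairs of columns *)

Lemma projected_A2E (C : numClosedFieldType) (S : finType)
    (c : 'I_#|S|.-1 -> S -> C) (I J : finType) (D : I -> J -> S)
    (K : {set J}) : orthonormal_contrasts c -> #|K| = 2%N ->
  projected_A2 c D K = #|I|%:R ^- 2 *
    \sum_i \sum_i' \prod_(k in K) (#|S|%:R * (D i k == D i' k)%:R - 1).
Proof.
move=> hc K2; rewrite /projected_A2 gwlpE //; congr (_ * _).
rewrite (big_pred1 setT) => [|K' /=].
  apply: eq_bigr => i _; apply: eq_bigr => i' _.
  by rewrite [RHS]big_sub; apply: eq_bigl => k; rewrite in_setT.
have cK : #|[set: {k | k \in K}]| = 2%N by rewrite cardsT card_sig -K2; apply: eq_card.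
have K'2 : (#|K'| <= 2)%N by rewrite -cK subset_leq_card ?subsetT.
by rewrite eqEcard subsetT cK eqn_leq K'2.
Qed.

Lemma gwlp2_projected (C : numClosedFieldType) (S : finType)
    (c : 'I_#|S|.-1 -> S -> C) (I J : finType) (D : I -> J -> S) :
  orthonormal_contrasts c ->
  gwlp c 2 D = \sum_(K : {set J} | #|K| == 2%N) projected_A2 c D K.
Proof.
move=> hc; rewrite gwlpE // mulr_sumr; apply: eq_bigr => K /eqP K2.
by rewrite projected_A2E.
Qed.

Lemma projected_A2_pair (C : numClosedFieldType) (S : finType)
    (c : 'I_#|S|.-1 -> S -> C) (I J : finType) (D : I -> J -> S) (p q : J) :
  orthonormal_contrasts c -> p != q ->
  projected_A2 c D [set p; q] = pairA2 C (D^~ p) (D^~ q).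
Proof.
move=> hc pq; rewrite projected_A2E ?cards2 ?pq //; congr (_ * _).
apply: eq_bigr => i _; apply: eq_bigr => i' _.
by rewrite big_setU1 ?inE //= big_set1.
Qed.

(** * Labels of a juxtaposition *)

Lemma sum_jlabel (R : Type) (idx : R) (op : Monoid.com_law idx)
    (F : finFieldType) (n k : nat) (Q : 'I_k -> {set column F n})
    (G : 'I_k * column F n -> R) :
  \big[op/idx]_(q : jlabel Q) G (val q) =
  \big[op/idx]_i \big[op/idx]_(f in Q i) G (i, f).
Proof.
rewrite -(big_sub (fun q : 'I_k * column F n => q.2 \in Q q.1)) /=.
by rewrite pair_big_dep; apply: eq_big => [[i f]|[i f] _].
Qed.

(** Counting unordered pairs of labels with a property B that fails for two labels
    of the same family: each pair is listed with its family indices increasing. *)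
Lemma card_jlabel_pairs (F : finFieldType) (n k : nat)
    (Q : 'I_k -> {set column F n}) (B : {set jlabel Q} -> bool)
    (b : 'I_k * column F n -> 'I_k * column F n -> bool) :
  (forall p q : jlabel Q, p != q ->
     B [set p; q] = ((val p).1 != (val q).1) && b (val p) (val q)) ->
  #|[set K : {set jlabel Q} | (#|K| == 2%N) && B K]| =
  (\sum_(j < k) \sum_(i < k | (i < j)%N)
      \sum_(f in Q i) \sum_(g in Q j) b (i, f) (j, g))%N.
Proof.
move=> Bb.
pose A := [set pq : jlabel Q * jlabel Q |
            ((val pq.1).1 < (val pq.2).1)%N && b (val pq.1) (val pq.2)].
have A_neq p q : (p, q) \in A -> p != q.
  by rewrite inE => /andP[+ _]; apply: contraTneq => ->; rewrite ltnn.
pose u (pq : jlabel Q * jlabel Q) := [set pq.1; pq.2].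
have u_inj : {in A &, injective u}.
  move=> [p q] [p' q'] pqA p'q'A; rewrite /u /= => e.
  have := A_neq _ _ pqA.
  have lt1 : ((val p).1 < (val q).1)%N by move: pqA; rewrite inE => /andP[].
  have lt2 : ((val p').1 < (val q').1)%N by move: p'q'A; rewrite inE => /andP[].
  have : p \in [set p'; q'] by rewrite -e set21.
  have : q \in [set p'; q'] by rewrite -e set22.
  rewrite !inE => /orP[] /eqP qE /orP[] /eqP pE; rewrite ?qE ?pE ?eqxx // => _.
  by move: lt1; rewrite pE qE ltnNge (ltnW lt2).
transitivity #|[set u pq | pq in A]|.
  apply: eq_card => K; rewrite inE; apply/andP/imsetP.
    case=> /cards2P[p [q [pq ->]]]; rewrite Bb // => /andP[ne bpq].
    move: ne; rewrite neq_ltn => /orP[lt|lt].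
      by exists (p, q); rewrite // inE lt.
    exists (q, p); last by rewrite /u setUC.
    rewrite inE lt /=; have := Bb q p; rewrite eq_sym setUC => /(_ pq).
    by rewrite Bb // bpq andbT neq_ltn lt orbT => /esym/andP[_ ->].
  case=> -[p q] pqA ->; have pq := A_neq _ _ pqA.
  rewrite /u /= cards2 pq Bb //; move: pqA; rewrite inE => /andP[lt ->].
  by rewrite neq_ltn lt.
rewrite card_in_imset // -sum1_card big_mkcond /=.
transitivity (\sum_(p : jlabel Q) \sum_(q : jlabel Q)
   (((val p).1 < (val q).1)%N && b (val p) (val q)))%N.
  by rewrite pair_bigA; apply: eq_bigr => -[p q] _; rewrite inE /=; case: (_ && _).
rewrite (sum_jlabel _ Q (fun p => \sum_(q : jlabel Q)
          ((p.1 < (val q).1) && b p (val q))))%N.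
transitivity (\sum_(i < k) \sum_(f in Q i) \sum_(j < k) \sum_(g in Q j)
   ((i < j) && b (i, f) (j, g)))%N.
  apply: eq_bigr => i _; apply: eq_bigr => f _.
  by rewrite (sum_jlabel _ Q (fun q => nat_of_bool ((i < q.1) && b (i, f) q)))%N.
rewrite [RHS](exchange_big_dep predT) //=; apply: eq_bigr => i _.
rewrite exchange_big [RHS]big_mkcond; apply: eq_bigr => j _ /=.
by case: ltnP => // _; rewrite !big1 // => f _; rewrite big1.
Qed.

Lemma sum_ltn_pairs (k N : nat) :
  (\sum_(j < k) \sum_(i < k | (i < j)%N) N = 'C(k, 2) * N)%N.
Proof.
rewrite -bin2_sum big_mkord big_distrl; apply: eq_bigr => j _ /=.
rewrite sum_nat_const; congr (_ * _)%N.
by rewrite -[RHS](card_ord j) -sum1_card -(big_ord_widen _ (fun=> 1%N)) ?sum1_card // ltnW.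
Qed.

(** * The families of quadratic columns *)

(** The columns h^2 + a h + g, with h given by the coefficient vector c, and g
    normalised without the variable of index l. *)
Definition quad_family (F : finFieldType) (n : nat) (c : 'rV[F]_n) (l : 'I_n) :
    {set column F n} :=
  [set qcol c (p.1 *: c + p.2) | p in setX [set: F] (normalised_without F l)].

Lemma family_inj (F : finFieldType) (n : nat) (c : 'rV[F]_n) (l : 'I_n) :
  last_is_one c l ->
  {in setX [set: F] (normalised_without F l) &,
     injective (fun p : F * 'rV_n => qcol c (p.1 *: c + p.2))}.
Proof.
move=> /andP[/eqP cl _] [a e] [a' e']; rewrite !in_setX.
move=> /andP[_ eE] /andP[_ e'E] /qcol_inj E.
move: eE e'E; rewrite !in_set /= => /andP[_ /eqP el] /andP[_ /eqP e'l].
have := congr1 (fun v : 'rV_n => v 0 l) E; rewrite /= !mxE cl el e'l !mulr1 !addr0.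
by move=> aa; congr (_, _) => //; move: E; rewrite aa => /addrI.
Qed.

Lemma sum_family (R : Type) (idx : R) (op : Monoid.com_law idx)
    (F : finFieldType) (n : nat) (c : 'rV[F]_n) (l : 'I_n)
    (G : column F n -> R) : last_is_one c l ->
  \big[op/idx]_(f in quad_family c l) G f =
  \big[op/idx]_(a : F) \big[op/idx]_(e in normalised_without F l)
     G (qcol c (a *: c + e)).
Proof.
move=> cl; rewrite big_imset; last exact: family_inj.
rewrite pair_big_dep; apply: eq_bigl => -[a e].
by rewrite in_setX in_setT.
Qed.

Lemma lincomb_X (F : finFieldType) (n : nat) (c : 'rV[F]_n) :
  lincomb (X_ F n) c = [ffun x => dot c x].
Proof. by apply/ffunP => x; rewrite !ffunE; apply: eq_bigr => i _; rewrite ffunE. Qed.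

Lemma lincomb_X_inj (F : finFieldType) (n : nat) : injective (lincomb (X_ F n)).
Proof.
move=> c c'; rewrite !lincomb_X => /ffunP e; apply: dot_inj => x.
by have := e x; rewrite !ffunE.
Qed.

(** The linear form in the variables other than X_l, as a form in all of them. *)
Definition extend (F : finFieldType) (n : nat) (l : 'I_n) (b : 'rV[F]_n.-1) :
  'rV[F]_n := \row_j (if unlift l j is Some i then b 0 i else 0).

Lemma lincomb_lift (F : finFieldType) (n : nat) (l : 'I_n) (b : 'rV[F]_n.-1) :
  lincomb (fun i : 'I_n.-1 => X_ F n (lift l i)) b = [ffun x => dot (extend l b) x].
Proof.
apply/ffunP => x; rewrite !ffunE /dot (bigD1_ord l) //= mxE unlift_none mul0r add0r.
by apply: eq_bigr => i _; rewrite mxE liftK ffunE.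
Qed.

Lemma extend_normalised (F : finFieldType) (n : nat) (l : 'I_n) (b : 'rV[F]_n.-1) :
  (extend l b \in normalised_without F l) = (b \in normalised F n.-1).
Proof.
rewrite !in_set mxE unlift_none eqxx andbT.
apply/existsP/existsP => -[j /andP[/eqP bj /forallP aj]].
  move: bj aj; rewrite mxE; case: unliftP => [i ->|_ /eqP]; last first.
    by rewrite eq_sym oner_eq0.
  move=> bi aj; exists i; rewrite /last_is_one bi eqxx.
  apply/forallP => i'; have := aj (lift l i'); rewrite mxE liftK.
  by rewrite /= !ltnNge leq_bump2.
exists (lift l j); rewrite /last_is_one mxE liftK bj eqxx.
apply/forallP => i; rewrite mxE; case: unliftP => [i' ->|_]; last by rewrite eqxx implybT.
by have := aj i'; rewrite /= !ltnNge leq_bump2.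
Qed.

Lemma extend_surj (F : finFieldType) (n : nat) (l : 'I_n) (e : 'rV[F]_n) :
  e 0 l = 0 -> e = extend l (\row_i e 0 (lift l i)).
Proof.
move=> el; apply/rowP => j; rewrite mxE; case: unliftP => [i ->|->//].
by rewrite mxE.
Qed.

Lemma H_lift (F : finFieldType) (n : nat) (l : 'I_n) :
  H (fun i : 'I_n.-1 => X_ F n (lift l i)) =
  [set [ffun x => dot e x] | e in normalised_without F l].
Proof.
apply/setP => g; apply/imsetP/imsetP => -[].
  move=> b bN ->; exists (extend l b); last by rewrite lincomb_lift.
  by rewrite extend_normalised in_set; rewrite inE in bN.
move=> e eE ->; have := eE; rewrite in_set => /andP[_ /eqP el].
exists (\row_i e 0 (lift l i)); last by rewrite lincomb_lift -extend_surj.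
by have := extend_normalised l (\row_i e 0 (lift l i)); rewrite -extend_surj // eE !inE.
Qed.

(** Q_h^* is the family of the normalised coefficient vector of h; the choice made
    in its definition is harmless, as this vector and its last index are unique. *)
Lemma Qstar_family (F : finFieldType) (n : nat) (c : 'rV[F]_n) (l : 'I_n) :
  last_is_one c l -> Qstar (lincomb (X_ F n) c) = quad_family c l.
Proof.
move=> cl; rewrite /Qstar; case: pickP => [[c' l'] /= /andP[/eqP e c'l']|]; last first.
  by move/(_ (c, l)); rewrite /= eqxx cl.
move/lincomb_X_inj: e => e; rewrite -e in c'l'; rewrite -(last_is_one_uniq cl c'l').
rewrite /Q1star H_lift lincomb_X; apply/setP => f; apply/imset2P/imsetP.
  case=> a g _ /imsetP[d dE ->] ->; exists (a, d); first by rewrite in_setX in_setT.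
  by apply/ffunP => x; rewrite !ffunE /= dotDl dotZl addrA.
case=> -[a d]; rewrite in_setX in_setT /= => dE ->.
exists a [ffun x => dot d x] => //; first by apply/imsetP; exists d.
by apply/ffunP => x; rewrite !ffunE /= dotDl dotZl addrA.
Qed.

Lemma card_family (F : finFieldType) (n : nat) (c : 'rV[F]_n) (l : 'I_n) :
  last_is_one c l -> #|quad_family c l| = (#|F| * #|normalised_without F l|)%N.
Proof.
by move=> cl; rewrite card_in_imset ?cardsX ?cardsT //; exact: family_inj.
Qed.

Lemma card_family_div (F : finFieldType) (n : nat) (c : 'rV[F]_n) (l : 'I_n) :
  last_is_one c l -> #|quad_family c l| = ((#|F| ^ n - #|F|) %/ (#|F| - 1))%N.
Proof.
move=> cl; have s1 : (0 < #|F| - 1)%N by rewrite subn_gt0 card_finNzRing_gt1.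
rewrite -[LHS](mulnK _ s1) card_family // -mulnA card_normalised_without.
by case: n c l cl => [|n] c l _; [case: l | rewrite mulnBr muln1 -expnS].
Qed.

Lemma family_balanced (F : finFieldType) (n : nat) (c : 'rV[F]_n) (l : 'I_n)
    (f : column F n) (v : F) : last_is_one c l -> f \in quad_family c l ->
  (#|[set x | f x == v]| * #|F| = #|F| ^ n)%N.
Proof.
move=> cl /imsetP[[a e]]; rewrite in_setX in_setT /= => eE ->.
by rewrite qcol_balanced // (family_form_notin _ cl).
Qed.

(** The quantity s * coincidences - number of columns, for a single family. *)
Lemma sum_family_contrast (R : numFieldType) (F : finFieldType) (n : nat)
    (c x y : 'rV[F]_n) (l : 'I_n) : last_is_one c l ->
  \sum_(f in quad_family c l) (#|F|%:R * (f x == f y)%:R - 1) =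
  #|F|%:R ^+ n * (x == y)%:R - #|F|%:R * (dot c x == dot c y)%:R :> R.
Proof.
move=> cl; rewrite sumrB -mulr_sumr sumr_const card_family // natrM.
have n0 : n = n.-1.+1 by case: n l {c x y cl} => [[]|].
have s1 := card_finNzRing_gt1 F.
have EM : #|normalised_without F l|%:R * (#|F|%:R - 1) = #|F|%:R ^+ n.-1 - 1 :> R.
  have := congr1 (fun u => u%:R : R) (card_normalised_without F l).
  by rewrite natrM !natrB ?natrX ?expn_gt0 ?(ltnW s1).
have [<-|xy] := eqVneq x y.
  under eq_bigr do rewrite eqxx.
  rewrite sumr_const card_family // natrM eqxx !mulr1.
  have -> : #|F|%:R ^+ n = #|F|%:R * #|F|%:R ^+ n.-1 :> R by rewrite -exprS -n0.
  by rewrite -[_ ^+ n.-1](subrK 1) -EM; ring.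
rewrite mulr0 sub0r sum_family //.
have /(congr1 (fun u => u%:R : R)) := card_agree_family cl xy.
rewrite natrD natr_sum; under eq_bigr do rewrite natr_sum.
by move=> <-; ring.
Qed.

(** The sum of all projected values between two families: after exchanging the
    sums, the columns of each family enter only through their total. *)
Lemma sum_pairA2_families (R : numFieldType) (F : finFieldType) (n : nat)
    (c c' : 'rV[F]_n) (l l' : 'I_n) :
  last_is_one c l -> last_is_one c' l' -> c != c' ->
  \sum_(f in quad_family c l) \sum_(g in quad_family c' l') pairA2 R f g =
  #|F|%:R ^+ n - 2 * #|F|%:R + 1.
Proof.
move=> cl cl' cc'; set s : R := #|F|%:R.
have s0 : s != 0 by exact: field_card_neq0.
have cI : #|'rV[F]_n|%:R = s ^+ n :> R by rewrite card_mx mul1n natrX.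
have cN := last_is_one_normalised cl; have c'N := last_is_one_normalised cl'.
transitivity (#|'rV[F]_n|%:R ^- 2 * \sum_x \sum_y
   (\sum_(f in quad_family c l) (s * (f x == f y)%:R - 1)) *
   (\sum_(g in quad_family c' l') (s * (g x == g y)%:R - 1))).
  under eq_bigr do rewrite -mulr_sumr; rewrite -mulr_sumr; congr (_ * _).
  under eq_bigr do rewrite exchange_big; rewrite exchange_big.
  apply: eq_bigr => x _ /=.
  under eq_bigr do rewrite exchange_big; rewrite exchange_big.
  apply: eq_bigr => y _ /=.
  by rewrite mulr_suml; apply: eq_bigr => f _; rewrite -mulr_sumr.
have E x : \sum_y (\sum_(f in quad_family c l) (s * (f x == f y)%:R - 1)) *
   (\sum_(g in quad_family c' l') (s * (g x == g y)%:R - 1)) =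
   s ^+ n * (s ^+ n - 2 * s + 1).
  transitivity ((s ^+ n * (s ^+ n - 2 * s)) * (\sum_y (x == y)%:R)
     + s ^+ 2 * (\sum_y ((dot c y == dot c x) && (dot c' y == dot c' x))%:R) : R).
    rewrite !mulr_sumr -big_split; apply: eq_bigr => y _ /=.
    rewrite !sum_family_contrast // (eq_sym (dot c y)) (eq_sym (dot c' y)) -/s.
    have [<-|_] := eqVneq x y; first by rewrite !eqxx /=; ring.
    by case: (dot c x == _); case: (dot c' x == _) => /=; ring.
  rewrite !sum_indicator natr_card_fibre2 ?normalised_neq0 //; last first.
    exact: normalised_notin.
  rewrite (_ : [set y | x == y] = [set x]).
    by rewrite cards1 -/s; field.
  by apply/setP => y; rewrite !inE eq_sym.
rewrite (eq_bigr _ (fun x _ => E x)) sumr_const -[X in _ * X]mulr_natl cI.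
by field; rewrite expf_neq0.
Qed.

Lemma sum_plane_forms (F : finFieldType) (n : nat) (c c' : 'rV[F]_n) (l : 'I_n) :
  last_is_one c l -> c' \in normalised F n -> c != c' ->
  (\sum_(a : F) \sum_(e in normalised_without F l)
     ((a *: c + e)%R <= col_mx c c')%MS = #|F|)%N.
Proof.
move=> cl c'N cc'; have U := unique_normalised_in_plane cl c'N cc'.
transitivity (#|F| * #|[set e in normalised_without F l | (e <= col_mx c c')%MS]|)%N;
  last by rewrite U muln1.
rewrite -sum_nat_const; apply: eq_bigr => a _.
rewrite -sum1_card big_mkcond [RHS]big_mkcond; apply: eq_bigr => e _.
rewrite [in RHS]in_set; case: (e \in _) => //=.
have cW b : (b *: c <= col_mx c c')%MS.
  by apply/col_mx_rowP; exists b, 0; rewrite scale0r addr0.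
suff -> : ((a *: c + e)%R <= col_mx c c')%MS = (e <= col_mx c c')%MS.
  by case: (_ <= _)%MS.
apply/idP/idP => [acW|]; last exact: addmx_sub.
by rewrite -[e](addKr (a *: c)) addmx_sub // -scaleNr.
Qed.

Lemma odd_card_field_ge3 (F : finFieldType) : odd #|F| -> (2 < #|F|)%N.
Proof. by have := card_finNzRing_gt1 F; case: #|F| => [|[|[|]]]. Qed.

Lemma projected_values_neq (R : numFieldType) (F : finFieldType)
    (s : R := #|F|%:R) : odd #|F| ->
  [/\ (s - 1) / s ^+ 2 != 0, (s - 1) ^+ 2 / s ^+ 2 != 0
    & (s - 1) / s ^+ 2 != (s - 1) ^+ 2 / s ^+ 2].
Proof.
move=> oddF; have F3 := odd_card_field_ge3 oddF.
have s0 : s != 0 by exact: field_card_neq0.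
have s1 : s - 1 != 0 by rewrite subr_eq0 pnatr_eq1 gtn_eqF // ltnW.
have s2 : s - 1 - 1 != 0.
  by rewrite -addrA -opprD subr_eq0 -[1 + 1]/(2%:R) eqr_nat gtn_eqF.
split; rewrite ?mulf_neq0 ?invr_eq0 ?expf_neq0 //.
rewrite (inj_eq (mulIf _)) ?invr_eq0 ?expf_neq0 //.
by rewrite -subr_eq0 expr2 -{1}[s - 1]mulr1 -mulrBr mulf_neq0 // -opprB oppr_eq0.
Qed.

Lemma dvdn_exp_sub_sqr (q n : nat) : (1 < n)%N -> (q - 1 %| q ^ n - q ^ 2)%N.
Proof.
move=> n_gt1; have -> : (q ^ n - q ^ 2 = (q ^ (n - 2) - 1) * q ^ 2)%N.
  by rewrite mulnBl mul1n -expnD subnK.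
by rewrite dvdn_mulr // !subn1 predn_exp dvdn_mulr.
Qed.

(** Exactly s^2 pairs of columns from two families have both linear parts in
    the plane spanned by the two squared forms. *)
Lemma card_pairA2_large (R : numFieldType) (F : finFieldType) (n : nat)
    (c c' : 'rV[F]_n) (l l' : 'I_n) (s : R := #|F|%:R) :
  odd #|F| -> last_is_one c l -> last_is_one c' l' -> c != c' ->
  (\sum_(f in quad_family c l) \sum_(g in quad_family c' l')
     (pairA2 R f g == (s - 1) ^+ 2 / s ^+ 2) = #|F| ^ 2)%N.
Proof.
move=> oddF cl cl' cc'.
have s0 : s != 0 by exact: field_card_neq0.
have cN := last_is_one_normalised cl; have c'N := last_is_one_normalised cl'.
have [_] := projected_values_neq R oddF; rewrite -/s.
set v2 := (s - 1) ^+ 2 / s ^+ 2 => v20 v21.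
set W := col_mx c c'.
have W' b e : ((b *: c' + e)%R <= W)%MS = ((b *: c' + e)%R <= col_mx c' c)%MS.
  by rewrite sub_col_mxC.
transitivity ((\sum_(a : F) \sum_(e in normalised_without F l)
     ((a *: c + e)%R <= col_mx c c')%MS) *
   (\sum_(a : F) \sum_(e in normalised_without F l')
     ((a *: c' + e)%R <= col_mx c' c)%MS))%N; last first.
  by rewrite !sum_plane_forms // eq_sym.
rewrite sum_family // big_distrl /=; apply: eq_bigr => a _.
rewrite big_distrl /=; apply: eq_bigr => e eE.
rewrite sum_family // big_distrr /=; apply: eq_bigr => a' _.
rewrite big_distrr /=; apply: eq_bigr => e' e'E.
rewrite pairA2_diff ?(family_form_notin _ cl) ?(family_form_notin _ cl') //; last first.
  exact: odd_field_two_neq0.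
rewrite -W' -/W -/s -/v2.
case: (_ <= W)%MS; case: (_ <= W)%MS => /=; rewrite ?eqxx ?(eq_sym 0) ?(negPf v20) //.
by case: (_ <= _)%MS; rewrite ?(eq_sym 0) ?(negPf v20) ?(negPf v21).
Qed.

Lemma pairA2_families_values (R : numFieldType) (F : finFieldType) (n : nat)
    (c c' : 'rV[F]_n) (l l' : 'I_n) (f g : column F n) (s : R := #|F|%:R) :
  odd #|F| -> last_is_one c l -> last_is_one c' l' -> c != c' ->
  f \in quad_family c l -> g \in quad_family c' l' ->
  [\/ pairA2 R f g = 0, pairA2 R f g = (s - 1) ^+ 2 / s ^+ 2
    | pairA2 R f g = (s - 1) / s ^+ 2].
Proof.
move=> oddF cl cl' cc' /imsetP[[a e]]; rewrite in_setX in_setT /= => eE ->.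
case/imsetP=> -[a' e']; rewrite in_setX in_setT /= => e'E ->.
rewrite pairA2_diff ?(last_is_one_normalised cl) ?(last_is_one_normalised cl')
  ?(family_form_notin _ cl) ?(family_form_notin _ cl') ?odd_field_two_neq0 //.
by case: ifP => _; [constructor 2 | case: ifP => _; [constructor 3 | constructor 1]].
Qed.

(** The number of pairs with the smaller nonzero value follows from the total. *)
Lemma card_pairA2_small (R : numFieldType) (F : finFieldType) (n : nat)
    (c c' : 'rV[F]_n) (l l' : 'I_n) (s : R := #|F|%:R) :
  odd #|F| -> last_is_one c l -> last_is_one c' l' -> c != c' -> (1 < n)%N ->
  (\sum_(f in quad_family c l) \sum_(g in quad_family c' l')
     (pairA2 R f g == (s - 1) / s ^+ 2) =
   #|F| ^ 2 * ((#|F| ^ n - #|F| ^ 2) %/ (#|F| - 1)))%N.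
Proof.
move=> oddF cl cl' cc' n_gt1.
have s0 : s != 0 by exact: field_card_neq0.
have F3 := odd_card_field_ge3 oddF.
have [] := projected_values_neq R oddF; rewrite -/s.
set v1 := (s - 1) / s ^+ 2; set v2 := (s - 1) ^+ 2 / s ^+ 2 => v10 v20 v21.
have := sum_pairA2_families R cl cl' cc'.
have := card_pairA2_large R oddF cl cl' cc'; rewrite -/s -/v2.
set n1 := (\sum_(f in _) \sum_(g in _) (_ == v1))%N => E2 Etot.
have {}E2 := congr1 (fun u => u%:R : R) E2; rewrite natr_sum in E2.
have : s ^+ n - 2 * s + 1 = v2 * s ^+ 2 + v1 * n1%:R.
  rewrite -Etot -natrX -E2 natr_sum !mulr_sumr -big_split.
  apply: eq_bigr => f fE; rewrite !natr_sum !mulr_sumr -big_split.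
  apply: eq_bigr => g gE /=.
  case: (pairA2_families_values R oddF cl cl' cc' fE gE) => ->.
  - by rewrite ![0 == _]eq_sym (negPf v10) (negPf v20) !mulr0 addr0.
  - by rewrite -/s -/v2 eqxx eq_sym (negPf v21) mulr0 mulr1 addr0.
  - by rewrite -/s -/v1 eqxx (negPf v21) mulr0 mulr1 add0r.
rewrite /v2 /v1 => E.
have {}E : n1%:R * (s - 1) = s ^+ 2 * (s ^+ n - s ^+ 2).
  have -> : s ^+ n = (s - 1) ^+ 2 + (s - 1) / s ^+ 2 * n1%:R + 2 * s - 1.
    by rewrite -[LHS](addrNK (2 * s)) -[X in X + _](addrK 1) E divfK ?expf_neq0 //; ring.
  by field.
have F1 : (0 < #|F| - 1)%N by rewrite subn_gt0 ltnW.
have {}E : (n1 * (#|F| - 1) = #|F| ^ 2 * (#|F| ^ n - #|F| ^ 2))%N.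
  have le1 : (0 < #|F|)%N by rewrite ltnW // ltnW.
  have le2 : (#|F| ^ 2 <= #|F| ^ n)%N by rewrite leq_pexp2l.
  by apply/eqP; rewrite -(eqr_nat R) !natrM !natrB // !natrX E.
have dvd := dvdn_exp_sub_sqr #|F| n_gt1.
by rewrite muln_divA // -E mulnK.
Qed.

(** * Juxtapositions of quadratic families *)

Lemma jlabel_form (F : finFieldType) (n k : nat) (c : 'I_k -> 'rV[F]_n)
    (l : 'I_k -> 'I_n) (Q : 'I_k -> {set column F n}) :
  (forall i, Q i = quad_family (c i) (l i)) ->
  forall q : jlabel Q, (val q).2 \in quad_family (c (val q).1) (l (val q).1).
Proof. by move=> QE q; rewrite -QE; exact: valP q. Qed.

Lemma juxtaposition_SSD (F : finFieldType) (n k : nat) (c : 'I_k -> 'rV[F]_n)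
    (l : 'I_k -> 'I_n) (Q : 'I_k -> {set column F n}) :
  (forall i, last_is_one (c i) (l i)) ->
  (forall i, Q i = quad_family (c i) (l i)) ->
  is_SSD (#|F| ^ n) (k * ((#|F| ^ n - #|F|) %/ (#|F| - 1))) (juxtaposition Q).
Proof.
move=> cl QE; split; first by rewrite card_mx mul1n.
  rewrite -sum1_card (sum_jlabel _ Q (fun=> 1%N)).
  set N := (_ %/ _)%N.
  transitivity (\sum_(i < k) N)%N; last by rewrite sum_nat_const card_ord.
  apply: eq_bigr => i _.
  by rewrite sum1_card QE (card_family_div (cl i)).
by move=> q v; apply: family_balanced (cl _) (jlabel_form QE q).
Qed.

Lemma coincidence_juxtaposition (F : finFieldType) (n k : nat)
    (c : 'I_k -> 'rV[F]_n) (l : 'I_k -> 'I_n) (Q : 'I_k -> {set column F n})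
    (x y : 'rV[F]_n) :
  (forall i, last_is_one (c i) (l i)) ->
  (forall i, Q i = quad_family (c i) (l i)) -> x != y ->
  (coincidence (juxtaposition Q) x y + #|[set i | dot (c i) x == dot (c i) y]| =
   k * ((#|F| ^ n.-1 - 1) %/ (#|F| - 1)))%N.
Proof.
move=> cl QE xy.
have s1 : (0 < #|F| - 1)%N by rewrite subn_gt0 card_finNzRing_gt1.
rewrite /coincidence -!sum1dep_card big_mkcond [X in (_ + X)%N]big_mkcond /=.
rewrite (sum_jlabel _ Q (fun q => if q.2 x == q.2 y then 1 else 0)%N) -big_split /=.
set N := (_ %/ _)%N.
transitivity (\sum_(i < k) N)%N; last by rewrite sum_nat_const card_ord.
apply: eq_bigr => i _; rewrite /N.
rewrite -(card_normalised_without F (l i)) mulnK // -(card_agree_family (cl i) xy).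
by rewrite QE sum_family.
Qed.

(** If at most one normalised form is left out, the number of the forms h_i
    that vanish at a nonzero point takes one of two consecutive values. *)
Lemma card_forms_zero (F : finFieldType) (n k : nat) (c : 'I_k -> 'rV[F]_n)
    (d : 'rV[F]_n) :
  injective c -> (forall i, c i \in normalised F n) ->
  ((#|F| ^ n - 1) %/ (#|F| - 1) <= k.+1)%N -> d != 0 ->
  (#|[set i | dot (c i) d == 0%R]| <= (#|F| ^ n.-1 - 1) %/ (#|F| - 1) <=
   #|[set i | dot (c i) d == 0%R]|.+1)%N.
Proof.
move=> c_inj cN k_ge d0; set M := (_ %/ _)%N; set z := #|[set _ | _]|.
have s1 : (0 < #|F| - 1)%N by rewrite subn_gt0 card_finNzRing_gt1.
have NM : #|[set e in normalised F n | e \in zeros d]| = M.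
  by rewrite -[LHS](mulnK _ s1) card_normalised_zeros card_zeros_row.
have cardN : #|normalised F n| = ((#|F| ^ n - 1) %/ (#|F| - 1))%N.
  have z0 : zeros (0 : 'M[F]_n) = [set: 'rV[F]_n].
    by apply/setP => x; rewrite in_set mul0mx eqxx in_setT.
  have := card_normalised_zeros (0 : 'M[F]_n).
  rewrite z0 cardsT card_mx mul1n => <-; rewrite mulnK //.
  by apply: eq_card => e; rewrite [RHS]in_set in_setT andbT.
pose A := [set c i | i in 'I_k].
have cA : #|A| = k by rewrite card_imset // card_ord.
have AN : A \subset normalised F n by apply/subsetP => _ /imsetP[i _ ->].
pose B := [set e in normalised F n | e \in zeros d].
have zE : z = #|B :&: A|.
  rewrite /z -(card_imset _ c_inj); apply: eq_card => e; rewrite in_setI.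
  apply/imsetP/andP => [[i]|[+ /imsetP[i _ ei]]].
    rewrite inE => id ->; split; last exact: imset_f.
    by rewrite in_set cN zeros_row dotC.
  rewrite in_set zeros_row ei dotC => /andP[_ id].
  by exists i; rewrite ?inE.
rewrite zE -NM -/B subset_leq_card ?subsetIl //=.
rewrite -(cardsID A B) -[#|B :&: A|.+1]addn1 leq_add2l.
have : (#|B :\: A| <= #|normalised F n :\: A|)%N.
  apply/subset_leq_card/setSD/subsetP => e; by rewrite in_set => /andP[].
move/leq_trans; apply; rewrite cardsD (setIidPr AN) cA cardN.
by rewrite leq_subLR addn1.
Qed.

Lemma juxtaposition_GMA (C : numClosedFieldType) (F : finFieldType) (n k : nat)
    (contr : 'I_#|F|.-1 -> F -> C) (c : 'I_k -> 'rV[F]_n)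
    (l : 'I_k -> 'I_n) (Q : 'I_k -> {set column F n}) :
  orthonormal_contrasts contr -> injective c ->
  (forall i, last_is_one (c i) (l i)) ->
  (forall i, Q i = quad_family (c i) (l i)) -> (0 < k)%N ->
  ((#|F| ^ n - 1) %/ (#|F| - 1) <= k.+1)%N ->
  GMA_optimal contr (#|F| ^ n) (k * ((#|F| ^ n - #|F|) %/ (#|F| - 1)))
    (juxtaposition Q).
Proof.
move=> hc c_inj cl QE k_gt0 k_ge.
have cN i := last_is_one_normalised (cl i).
pose M := ((#|F| ^ n.-1 - 1) %/ (#|F| - 1))%N.
(* there are k M - z coincidences with z <= M <= z + 1 *)
apply: (gma_two_values (q := (k.-1 * M)%N)) (juxtaposition_SSD cl QE) _ => //.
  by rewrite ltnW // card_finNzRing_gt1.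
move=> x y yx; have xy : x - y != 0 by rewrite subr_eq0 eq_sym.
have := card_forms_zero c_inj cN k_ge xy; rewrite -/M.
have := coincidence_juxtaposition cl QE (x := x) (y := y).
rewrite eq_sym yx -/M => /(_ isT).
have -> : [set i | dot (c i) x == dot (c i) y] = [set i | dot (c i) (x - y) == 0].
  apply/setP => i; rewrite !inE -subr_eq0; congr (_ == 0).
  by rewrite dotDr -scaleN1r dotZr mulN1r.
have -> : (k * M = k.-1 * M + M)%N by rewrite addnC -mulSn prednK.
move: #|_| => z u; case/andP; rewrite leq_eqVlt => /orP[/eqP zM _|zM Mz].
  by left; apply: (@addIn z); rewrite u zM.
have ME : M = z.+1 by apply/eqP; rewrite eqn_leq Mz.
by right; apply: (@addIn z); rewrite u {2}ME addnS addSn.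
Qed.

(** Two distinct columns of one family are orthogonal; two columns of distinct
    families have one of the three possible projected values. *)
Lemma pairA2_labels (R : numFieldType) (F : finFieldType) (n k : nat)
    (c : 'I_k -> 'rV[F]_n) (l : 'I_k -> 'I_n) (Q : 'I_k -> {set column F n})
    (p q : jlabel Q) (s : R := #|F|%:R) :
  odd #|F| -> injective c -> (forall i, last_is_one (c i) (l i)) ->
  (forall i, Q i = quad_family (c i) (l i)) -> p != q ->
  ((val p).1 = (val q).1 -> pairA2 R (val p).2 (val q).2 = 0) /\
  [\/ pairA2 R (val p).2 (val q).2 = 0,
      pairA2 R (val p).2 (val q).2 = (s - 1) ^+ 2 / s ^+ 2
    | pairA2 R (val p).2 (val q).2 = (s - 1) / s ^+ 2].
Proof.
move=> oddF c_inj cl QE pq.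
have same : (val p).1 = (val q).1 -> pairA2 R (val p).2 (val q).2 = 0.
  move=> e1; have ne : (val p).2 != (val q).2.
    apply: contraNneq pq => e2; apply/eqP/val_inj.
    by rewrite [LHS]surjective_pairing [RHS]surjective_pairing e1 e2.
  have := jlabel_form QE p; have := jlabel_form QE q; rewrite -e1.
  case/imsetP=> -[a' e']; rewrite in_setX in_setT /= => e'E qE.
  case/imsetP=> -[a e]; rewrite in_setX in_setT /= => eE pE.
  rewrite pE qE (pairA2_same _ (cl (val p).1)) //.
  by apply: contraNneq ne => -[aE eE']; rewrite pE qE aE eE'.
split=> //; have [/same|ne] := eqVneq (val p).1 (val q).1; first by constructor 1.
apply: (pairA2_families_values R oddF (cl _) (cl _) _ (jlabel_form QE p) (jlabel_form QE q)).
by rewrite (inj_eq c_inj).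
Qed.

(** A fully aliased pair of balanced columns would have projected value s - 1. *)
Lemma not_fully_aliased (F : finFieldType) (n k : nat)
    (c : 'I_k -> 'rV[F]_n) (l : 'I_k -> 'I_n) (Q : 'I_k -> {set column F n})
    (p q : jlabel Q) :
  odd #|F| -> injective c -> (forall i, last_is_one (c i) (l i)) ->
  (forall i, Q i = quad_family (c i) (l i)) -> p != q ->
  ~ fully_aliased (juxtaposition Q) p q.
Proof.
move=> oddF c_inj cl QE pq [_ alias].
pose s : rat := #|F|%:R; have s0 : s != 0 by exact: field_card_neq0.
have F3 := odd_card_field_ge3 oddF.
have s3 : 3 <= s by rewrite /s ler_nat.
have n0 : n = n.-1.+1 by rewrite prednK // (leq_ltn_trans _ (ltn_ord (l (val p).1))).
have cI : #|'rV[F]_n| = (#|F| ^ n)%N by rewrite card_mx mul1n.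
have cI0 : (0 < #|'rV[F]_n|)%N by rewrite cI expn_gt0 ltnW // ltnW.
have bal (t : jlabel Q) v :
    (#|[set x | (val t).2 x == v]| * #|F| = #|'rV[F]_n|)%N.
  by rewrite cI (family_balanced _ (cl _) (jlabel_form QE t)).
have agr x : #|[set y | ((val p).2 y == (val p).2 x) && ((val q).2 y == (val q).2 x)]|%:R
    = s^-1 * #|'rV[F]_n|%:R :> rat.
  have := alias ((val p).2 x, (val q).2 x) (imset_f _ _) => -> //.
  by rewrite cI {2}n0 expnS natrM mulKf.
have E := pairA2_uniform cI0 (bal p) (bal q) agr.
have [_] := pairA2_labels rat oddF c_inj cl QE pq; rewrite E -/s.
have -> : s ^+ 2 * s^-1 - 1 = s - 1 by field.
have v0 : s - 1 != 0 by rewrite subr_eq0 pnatr_eq1 gtn_eqF // ltnW.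
case=> [/eqP|/(congr1 ( *%R^~ (s ^+ 2)))|/(congr1 ( *%R^~ (s ^+ 2)))].
- by rewrite (negPf v0).
- by rewrite divfK ?expf_neq0 // expr2 => /(mulfI v0); nra.
- by rewrite divfK ?expf_neq0 // -[RHS]mulr1 => /(mulfI v0); nra.
Qed.

Theorem theorem7 (C : numClosedFieldType) (F : finFieldType) (s n k : nat)
    (hs : #|F| = s) (s_odd : odd s)
    (k_gt1 : (1 < k)%N) (k_le : (k <= (s ^ n - 1) %/ (s - 1))%N)
    (h : 'I_k -> column F n) (h_in : forall i, h i \in H (X_ F n))
    (h_inj : injective h) :
  let Q := fun i => Qstar (h i) in
  let D := juxtaposition Q in
  let m := (k * ((s ^ n - s) %/ (s - 1)))%N in
  let v2 : C := (s%:R - 1) ^+ 2 / s%:R ^+ 2 in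
  let v1 : C := (s%:R - 1) / s%:R ^+ 2 in
  is_SSD (s ^ n) m D /\
  (forall p q : jlabel Q, p != q -> ~ fully_aliased D p q) /\
  (forall c : 'I_#|F|.-1 -> F -> C, orthonormal_contrasts c ->
    (forall K : {set jlabel Q}, #|K| = 2%N ->
       [\/ projected_A2 c D K = 0, projected_A2 c D K = v2
         | projected_A2 c D K = v1]) /\
    #|[set K : {set jlabel Q} | (#|K| == 2%N) && (projected_A2 c D K == v2)]|
      = ('C(k, 2) * s ^ 2)%N /\
    #|[set K : {set jlabel Q} | (#|K| == 2%N) && (projected_A2 c D K == v1)]|
      = ('C(k, 2) * s ^ 2 * ((s ^ n - s ^ 2) %/ (s - 1)))%N /\
    gwlp c 2 D = ('C(k, 2))%:R * (s%:R ^+ n - 2%:R * s%:R + 1) /\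
    (k = ((s ^ n - 1) %/ (s - 1) - 1)%N \/ k = ((s ^ n - 1) %/ (s - 1))%N ->
       GMA_optimal c (s ^ n) m D)).
Proof.
move=> Q D m v2 v1; subst s.
have [cf cfP] : exists cf : 'I_k -> 'rV[F]_n * 'I_n, forall i,
    last_is_one (cf i).1 (cf i).2 /\ h i = lincomb (X_ F n) (cf i).1.
  apply: (@fin_all_exists _ _ (fun i u => last_is_one u.1 u.2 /\
                                    h i = lincomb (X_ F n) u.1)) => i.
  have /imsetP[c] := h_in i; rewrite inE => /existsP[l cl] hE.
  by exists (c, l).
pose c i := (cf i).1; pose l i := (cf i).2.
have cl i : last_is_one (c i) (l i) by case: (cfP i).
have hE i : h i = lincomb (X_ F n) (c i) by case: (cfP i).
have c_inj : injective c by move=> i j e; apply: h_inj; rewrite !hE e.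
have QE i : Q i = quad_family (c i) (l i) by rewrite /Q hE (Qstar_family (cl i)).
have F3 := odd_card_field_ge3 s_odd.
have s1 : (0 < #|F| - 1)%N by rewrite subn_gt0 ltnW.
(* in dimension at most 1 there is at most one normalised form *)
have n_gt1 : (1 < n)%N.
  rewrite ltnNge; apply: contraL k_gt1 => n1; rewrite -leqNgt (leq_trans k_le) //.
  by case: n n1 {h h_in h_inj Q D m cf cfP c l cl hE c_inj QE k_le} => [|[|]] // _;
     rewrite ?expn0 ?subnn ?div0n // expn1 divnn s1.
have ssd : is_SSD (#|F| ^ n) m D by apply: juxtaposition_SSD QE.
split=> //; split; first by move=> p q; apply: not_fully_aliased QE.
move=> contr hc.
pose s : C := #|F|%:R; have s0 : s != 0 by exact: field_card_neq0.
have [] := projected_values_neq C s_odd; rewrite -/v1 -/v2 => v1n0 v2n0 v12.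
have proj p q : p != q ->
    projected_A2 contr D [set p; q] = pairA2 C (val p).2 (val q).2.
  exact: projected_A2_pair.
have proj3 (K : {set jlabel Q}) : #|K| = 2%N ->
    [\/ projected_A2 contr D K = 0, projected_A2 contr D K = v2
      | projected_A2 contr D K = v1].
  move=> /eqP/cards2P[p [q [pq ->]]]; rewrite proj //.
  by have [] := pairA2_labels C s_odd c_inj cl QE pq.
have count v N : v != 0 ->
    (forall i j, c i != c j ->
       \sum_(f in quad_family (c i) (l i)) \sum_(g in quad_family (c j) (l j))
          (pairA2 C f g == v) = N)%N ->
    #|[set K : {set jlabel Q} | (#|K| == 2%N) && (projected_A2 contr D K == v)]|
      = ('C(k, 2) * N)%N.
  move=> v0 cN.
  rewrite (card_jlabel_pairs (b := fun p q => pairA2 C p.2 q.2 == v)).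
    rewrite -sum_ltn_pairs; apply: eq_bigr => j _; apply: eq_bigr => i ij /=.
    by rewrite !QE cN // (inj_eq c_inj) neq_ltn ij.
  move=> p q pq; rewrite proj //.
  have [same _] := pairA2_labels C s_odd c_inj cl QE pq.
  by have [/same ->|//] := eqVneq (val p).1 (val q).1; rewrite eq_sym (negPf v0).
have count2 := count v2 _ v2n0
  (fun i j => card_pairA2_large C s_odd (cl i) (cl j)).
have count1 := count v1 _ v1n0
  (fun i j ne => card_pairA2_small C s_odd (cl i) (cl j) ne n_gt1).
split; first exact: proj3.
split; first exact: count2.
split; first by rewrite count1 mulnA.
split; last first.
  move=> k_eq; apply: juxtaposition_GMA hc c_inj cl QE (ltnW k_gt1) _.
  by case: k_eq => ->; rewrite ?leqnSn // -[X in (_ <= X)%N]add1n -leq_subLR.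
rewrite gwlp2_projected //.
transitivity (v2 * #|[set K : {set jlabel Q} |
                   (#|K| == 2%N) && (projected_A2 contr D K == v2)]|%:R
  + v1 * #|[set K : {set jlabel Q} |
                   (#|K| == 2%N) && (projected_A2 contr D K == v1)]|%:R).
  rewrite -!sum_indicator !mulr_sumr -big_split big_mkcond; apply: eq_bigr => K _ /=.
  case: eqP => [K2|_] /=; last by rewrite !mulr0 addr0.
  case: (proj3 K K2) => ->.
  - by rewrite ![0 == _]eq_sym (negPf v1n0) (negPf v2n0) !mulr0 addr0.
  - by rewrite eqxx eq_sym (negPf v12) mulr0 mulr1 addr0.
  - by rewrite eqxx (negPf v12) mulr0 mulr1 add0r.
rewrite count2 count1 !natrM -/s.
have dvd := dvdn_exp_sub_sqr #|F| n_gt1.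
have le1 : (0 < #|F|)%N by rewrite ltnW // ltnW.
have le2 : (#|F| ^ 2 <= #|F| ^ n)%N by rewrite leq_pexp2l.
have := congr1 (fun u => u%:R : C) (divnK dvd).
rewrite natrM !natrB // !natrX -/s.
set N1 : C := _%:R => N1E.
have -> : s ^+ n = N1 * (s - 1) + s ^+ 2 by rewrite N1E subrK.
by rewrite /v1 /v2 -/s; field.
Qed.
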